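(* Let $n$ be an even integer $\ge4$ and $n_1:=n/2$. Let $\nu$ be the function from the set of odd integers to $\mathbb{Z}$ given by $\nu(u):=\frac{u-1}{4}$ if $u\equiv1\bmod4$ and $\nu(u):=\frac{u+1}{4}$ if $u\equiv3\bmod4$. Consider the formula $$ \varrho\big(m,(r^{2k},r^{-2k},r^{\varkappa(m)})\big):=\big(k+n_1\mathbb{Z},\ (2m+1)+2n\mathbb{Z}\big).\qquad( * ) $$ If $4\nmid n$, then $( * )$ defines a group isomorphism $\mathsf{GT}(\mathsf{K}^{(n)})\to\mathbb{Z}/n_1\mathbb{Z}\rtimes(\mathbb{Z}/2n\mathbb{Z})^\times$. If $4\mid n$, then $( * )$ defines an isomorphism from the group $\mathsf{GT}(\mathsf{K}^{(n)})$ onto the following index $2$ subgroup of $\mathbb{Z}/n_1\mathbb{Z}\rtimes(\mathbb{Z}/2n\mathbb{Z})^\times$: $$ H_n:=\big\{(\overline k,\overline u)\in\mathbb{Z}/n_1\mathbb{Z}\rtimes(\mathbb{Z}/2n\mathbb{Z})^\times\ \big|\ k\equiv\nu(u)\bmod2\big\}. $$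
   Context: **Semidirect product.** $\mathbb{Z}/n_1\mathbb{Z}\rtimes(\mathbb{Z}/2n\mathbb{Z})^\times$ has multiplication $(\overline k_1,\overline u_1)(\overline k_2,\overline u_2)=(\overline k_1+\overline u_1\overline k_2,\overline u_1\overline u_2)$, where units mod $2n$ act on $\mathbb{Z}/n_1\mathbb{Z}$ through reduction mod $n_1$. **Braid groups.** $\mathrm{B}_3=\langle \sigma_1,\sigma_2\mid \sigma_1\sigma_2\sigma_1=\sigma_2\sigma_1\sigma_2\rangle$; $\mathrm{PB}_3$ is the kernel of the standard homomorphism $\mathrm{B}_3\to S_3$; $x_{12}:=\sigma_1^2$, $x_{23}:=\sigma_2^2$, $c:=(\sigma_1\sigma_2\sigma_1)^2$. One has $\mathrm{PB}_3=\langle x_{12},x_{23}\rangle\times\langle c\rangle$ with $\langle x_{12},x_{23}\rangle$ free; $\mathsf{F}_2$ denotes the subgroup $\langle x_{12},x_{23}\rangle$, with $x:=x_{12}$, $y:=x_{23}$. $\mathsf{NFI}_{\mathrm{PB}_3}(\mathrm{B}_3)$ is the set of finite index normal subgroups $\mathsf{N}\unlhd\mathrm{B}_3$ with $\mathsf{N}\le\mathrm{PB}_3$. For such $\mathsf{N}$: $\mathsf{N}_{\mathsf{F}_2}:=\mathsf{N}\cap\mathsf{F}_2$, and $N_{\mathrm{ord}}$ is the lcm of the orders of $x_{12}\mathsf{N}$, $x_{23}\mathsf{N}$, $c\mathsf{N}$ in $\mathrm{PB}_3/\mathsf{N}$. **$\mathsf{GT}$-shadows.** For $(m,f)\in\mathbb{Z}\times\mathsf{F}_2$,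 $[m,f]:=(m+N_{\mathrm{ord}}\mathbb{Z}, f\mathsf{N}_{\mathsf{F}_2})$. $\mathsf{GT}(\mathsf{N})$ is the set of those $[m,f]\in\mathbb{Z}/N_{\mathrm{ord}}\mathbb{Z}\times\mathsf{F}_2/\mathsf{N}_{\mathsf{F}_2}$ such that: (i) the hexagon relations hold: $\sigma_1^{2m+1}f^{-1}\sigma_2^{2m+1}f\,\mathsf{N}=f^{-1}\sigma_1\sigma_2x_{12}^{-m}c^m\,\mathsf{N}$ and $f^{-1}\sigma_2^{2m+1}f\sigma_1^{2m+1}\,\mathsf{N}=\sigma_2\sigma_1x_{23}^{-m}c^mf\,\mathsf{N}$; (ii) $\gcd(2m+1,N_{\mathrm{ord}})=1$ and $f\mathsf{N}_{\mathsf{F}_2}\in[\mathsf{F}_2/\mathsf{N}_{\mathsf{F}_2},\mathsf{F}_2/\mathsf{N}_{\mathsf{F}_2}]$; (iii) the homomorphism $T_{m,f}:\mathrm{B}_3\to\mathrm{B}_3/\mathsf{N}$, $\sigma_1\mapsto\sigma_1^{2m+1}\mathsf{N}$, $\sigma_2\mapsto f^{-1}\sigma_2^{2m+1}f\,\mathsf{N}$ (well defined by (i)), is surjective. $\mathsf{N}$ is called isolated if $\ker T_{m,f}=\mathsf{N}$ for all $[m,f]\in\mathsf{GT}(\mathsf{N})$; then $\mathsf{GT}(\mathsf{N})$ is a finite group under $[m_1,f_1]\circ[m_2,f_2]=[2m_1m_2+m_1+m_2,\ f_1E_{m_1,f_1}(f_2)]$, where $E_{m,f}\in\mathrm{End}(\mathsf{F}_2)$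 is given by $x\mapsto x^{2m+1}$, $y\mapsto f^{-1}y^{2m+1}f$. **The subgroups $\mathsf{K}^{(n)}$.** For an integer $n\ge3$ let $D_n=\langle r,s\mid r^n,s^2,srs^{-1}r\rangle$, and let $\psi_n:\mathrm{PB}_3\to D_n^3$ be the homomorphism $\psi_n(x_{12})=(r,s,s)$, $\psi_n(x_{23})=(rs,r,rs)$, $\psi_n(c)=(1,1,1)$. Set $\mathsf{K}^{(n)}:=\ker\psi_n$. It is a fact that $\mathsf{K}^{(n)}\in\mathsf{NFI}_{\mathrm{PB}_3}(\mathrm{B}_3)$, that it is isolated (so $\mathsf{GT}(\mathsf{K}^{(n)})$ is a finite group), and that $K^{(n)}_{\mathrm{ord}}=\mathrm{lcm}(n,2)$ ($=n$ for $n$ even). Via $\psi_n$, $\mathsf{F}_2/\mathsf{K}^{(n)}_{\mathsf{F}_2}$ is identified with the subgroup $\langle(r,s,s),(rs,r,rs)\rangle\le D_n^3$. With this identification, it is a fact that for $n$ even $\mathsf{GT}(\mathsf{K}^{(n)})$ consists of the pairs $(m,(r^{2k},r^{-2k},r^{\varkappa(m)}))$ with $m\in\{0,\dots,n-1\}$, $\gcd(2m+1,n)=1$, $k\in\mathbb{Z}$, and, in the case $4\mid n$, additionally $k\equiv\varkappa(m)/2\bmod2$; here $\varkappa(m)=m+1$ for $m$ odd and $\varkappa(m)=-m$ for $m$ even. *)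

(* Defs.v *)
From HB Require Import structures.
From mathcomp Require Import all_boot all_order all_algebra all_fingroup.
From mathcomp Require Import boolp.

Set Implicit Arguments.
Unset Strict Implicit.
Unset Printing Implicit Defensive.

Import GroupScope.
Local Open Scope group_scope.

Local Notation qrepr := generic_quotient.repr.

Notation "{ 'hom' G -> H }" := (UMagmaMorphism.type G H)
  (at level 0, G at level 98, H at level 99, format "{ 'hom'  G  ->  H }").

Record subgroup (G : groupType) := Subgroup {
  sg_pred :> {pred G};
  sg_closed : group_closed sg_pred }.

Definition sg_type (G : groupType) (H : subgroup G) : Type :=
  {x : G | x \in H}.

HB.instance Definition _ (G : groupType) (H : subgroup G) :=
  SubChoice.on (sg_type H).
HB.instance Definition _ (G : groupType) (H : subgroup G) :=
  SubChoice_isSubGroup.Build G (fun x => x \in H) (sg_type H)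
    (sg_closed H).

Coercion sg_type : subgroup >-> Sortclass.

Definition gen_pred (G : groupType) (S : G -> Prop) : {pred G} :=
  [pred g | `[< forall H : subgroup G, (forall x, S x -> x \in H) ->
                  g \in H >]].

Lemma gen_closed (G : groupType) (S : G -> Prop) : group_closed (gen_pred S).
Proof.
split=> [|x y /asboolP Hx /asboolP Hy]; apply/asboolP => H HS.
  by have [] := sg_closed H.
by have [_] := sg_closed H; apply; [apply: Hx | apply: Hy].
Qed.

Definition gen (G : groupType) (S : G -> Prop) : subgroup G :=
  Subgroup (gen_closed S).

Definition derived (G : groupType) : subgroup G :=
  gen (fun z => exists x y : G, z = [~ x, y]).

Record normal_subgroup (G : groupType) := NormalSubgroup {
  nsg_subgroup :> subgroup G;
  nsg_normal : forall x g : G, x \in nsg_subgroup ->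
                               x ^ g \in nsg_subgroup }.

Section Quotient.
Variables (G : groupType) (N : normal_subgroup G).
Implicit Types x y z : G.

Definition coset_eq : rel G := fun x y => x^-1 * y \in N.

Lemma nsg1 : 1 \in N. Proof. by have [] := sg_closed N. Qed.
Lemma nsgV x : x \in N -> x^-1 \in N.
Proof. exact: group_closedV (sg_closed N) x. Qed.
Lemma nsgM x y : x \in N -> y \in N -> x * y \in N.
Proof. exact: group_closedM (sg_closed N) x y. Qed.

Lemma coset_eq_equiv : equiv_class_of coset_eq.
Proof.
split=> [x|x y|y x z]; rewrite /coset_eq.
- by rewrite mulVg nsg1.
- by apply/idP/idP => /nsgV; rewrite invgM invgK.
- by move=> Hx /(nsgM Hx); rewrite mulgA mulgK.
Qed.

Canonical coset_eq_equivRel := EquivRelPack coset_eq_equiv.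

Definition quot : Type := {eq_quot coset_eq}%qT.
HB.instance Definition _ := Choice.on quot.
HB.instance Definition _ := EqQuotient.on quot.

Definition in_quot (x : G) : quot := \pi_quot%qT x.

Definition quot_one : quot := in_quot 1.
Definition quot_mul (p q : quot) : quot := in_quot (qrepr p * qrepr q).
Definition quot_inv (p : quot) : quot := in_quot (qrepr p)^-1.

Lemma in_quot_eqE x y : (in_quot x = in_quot y) <-> x^-1 * y \in N.
Proof. by split=> [/eqquotP | ?]; last apply/eqquotP. Qed.

Lemma repr_quotP x : (qrepr (in_quot x))^-1 * x \in N.
Proof. by apply/in_quot_eqE; apply: reprK. Qed.

Lemma quot_mulE x y : quot_mul (in_quot x) (in_quot y) = in_quot (x * y).
Proof.
rewrite /quot_mul.
move: (repr_quotP x) (repr_quotP y).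
set x' := qrepr _; set y' := qrepr _ => Hx Hy.
apply/(in_quot_eqE (x' * y')).
have := nsgM (nsg_normal y' Hx) Hy.
by rewrite /conjg invgM !mulgA !mulgK.
Qed.

Lemma quot_invE x : quot_inv (in_quot x) = in_quot x^-1.
Proof.
rewrite /quot_inv.
move: (repr_quotP x); set x' := qrepr _ => Hx.
apply/(in_quot_eqE (x'^-1)).
have := nsg_normal x'^-1 (nsgV Hx).
by rewrite /conjg invgM !invgK !mulgA mulgK.
Qed.

Lemma quot_oneE : quot_one = in_quot 1.
Proof. by []. Qed.

Lemma quotW (P : quot -> Prop) : (forall x, P (in_quot x)) -> forall q, P q.
Proof. by move=> HP q; rewrite -[q]reprK; apply: HP. Qed.

Lemma quot_mulA : associative quot_mul.
Proof.
by elim/quotW=> x; elim/quotW=> y; elim/quotW=> z; rewrite !quot_mulE mulgA.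
Qed.
Lemma quot_mul1 : left_id quot_one quot_mul.
Proof. by elim/quotW=> x; rewrite quot_oneE quot_mulE mul1g. Qed.
Lemma quot_mul1r : right_id quot_one quot_mul.
Proof. by elim/quotW=> x; rewrite quot_oneE quot_mulE mulg1. Qed.
Lemma quot_mulV : left_inverse quot_one quot_inv quot_mul.
Proof. by elim/quotW=> x; rewrite quot_oneE quot_invE quot_mulE mulVg. Qed.
Lemma quot_mulVr : right_inverse quot_one quot_inv quot_mul.
Proof. by elim/quotW=> x; rewrite quot_oneE quot_invE quot_mulE mulgV. Qed.

HB.instance Definition _ := isGroup.Build quot
  quot_mulA quot_mul1 quot_mul1r quot_mulV quot_mulVr.

Lemma in_quotM : {morph in_quot : x y / x * y}.
Proof. by move=> x y; rewrite -quot_mulE. Qed.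
HB.instance Definition _ := isUMagmaMorphism.Build G quot in_quot
  (erefl, in_quotM).

Lemma in_quot1P x : in_quot x = 1 <-> x \in N.
Proof.
rewrite -[1]/quot_one quot_oneE; split=> [/esym/in_quot_eqE|Hx].
  by rewrite invg1 mul1g.
by apply/esym/in_quot_eqE; rewrite invg1 mul1g.
Qed.

End Quotient.

(* Words in the letters i and i^-1; (i, false) is i and (i, true) is i^-1. *)
Definition word (I : choiceType) := seq (I * bool).

Section Presented.
Variables (I : choiceType) (rels : seq (word I * word I)).

(* The congruence on words generated by the free cancellations and by the
   relations l = r, for (l, r) in rels. *)
Inductive word_eq : word I -> word I -> Prop :=
| WordRefl u : word_eq u u
| WordSym u v : word_eq u v -> word_eq v u
| WordTrans u v w : word_eq u v -> word_eq v w -> word_eq u w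
| WordCancel u v i b : word_eq (u ++ [:: (i, b); (i, ~~ b)] ++ v) (u ++ v)
| WordRel u v p : p \in rels -> word_eq (u ++ p.1 ++ v) (u ++ p.2 ++ v).

Lemma word_eq_ctx u v w w' :
  word_eq w w' -> word_eq (u ++ w ++ v) (u ++ w' ++ v).
Proof.
elim=> {w w'} [w|w w' _|w1 w2 w3 _ H1 _ H2|w w' i b|w w' p Hp].
- exact: WordRefl.
- exact: WordSym.
- exact: WordTrans H1 H2.
- by rewrite -!catA !(catA u); apply: WordCancel.
- by rewrite -!catA !(catA u); apply: WordRel.
Qed.

Definition word_eqb : rel (word I) := fun u v => `[< word_eq u v >].

Lemma word_eqb_equiv : equiv_class_of word_eqb.
Proof.
split=> [u|u v|v u w].
- by apply/asboolP; apply: WordRefl.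
- by apply/asboolP/asboolP; apply: WordSym.
- by move=> /asboolP Huv /asboolP Hvw; apply/asboolP; apply: WordTrans Huv Hvw.
Qed.
Canonical word_eqb_equivRel := EquivRelPack word_eqb_equiv.

Definition presented : Type := {eq_quot word_eqb}%qT.
HB.instance Definition _ := Choice.on presented.
HB.instance Definition _ := EqQuotient.on presented.

Definition pword (u : word I) : presented := \pi_presented%qT u.

Definition word_inv (u : word I) : word I :=
  rev [seq (a.1, ~~ a.2) | a <- u].

Definition presented_one : presented := pword [::].
Definition presented_mul (g h : presented) : presented :=
  pword (qrepr g ++ qrepr h).
Definition presented_inv (g : presented) : presented :=
  pword (word_inv (qrepr g)).

Lemma pword_eqE u v : (pword u = pword v) <-> word_eq u v.
Proof.
split=> [/eqquotP/asboolP //| Huv].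
by apply/eqquotP/asboolP.
Qed.

Lemma repr_pwordP u : word_eq (qrepr (pword u)) u.
Proof. by apply/pword_eqE; apply: reprK. Qed.

Lemma word_eq_cat u u' v v' :
  word_eq u u' -> word_eq v v' -> word_eq (u ++ v) (u' ++ v').
Proof.
move=> Hu Hv; apply: (@WordTrans _ (u' ++ v)).
  exact: (@word_eq_ctx [::] v).
by have := word_eq_ctx u' [::] Hv; rewrite !cats0.
Qed.

Lemma presented_mulE u v : presented_mul (pword u) (pword v) = pword (u ++ v).
Proof.
apply/(pword_eqE (_ ++ _)).
by apply: word_eq_cat; apply: repr_pwordP.
Qed.

Lemma word_invK : involutive word_inv.
Proof.
move=> u; rewrite /word_inv map_rev revK -map_comp -[RHS]map_id.
by apply: eq_map => -[i b] /=; rewrite negbK.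
Qed.

Lemma word_inv_cat u v : word_inv (u ++ v) = word_inv v ++ word_inv u.
Proof. by rewrite /word_inv map_cat rev_cat. Qed.

Lemma word_invl u : word_eq (word_inv u ++ u) [::].
Proof.
elim: u => [|[i b] u IHu]; first exact: WordRefl.
rewrite -[_ :: u]cat1s word_inv_cat -catA.
apply: WordTrans IHu.
by have := WordCancel (word_inv u) u i (~~ b); rewrite negbK.
Qed.

Lemma word_invr u : word_eq (u ++ word_inv u) [::].
Proof. by have := word_invl (word_inv u); rewrite word_invK. Qed.

Lemma word_eq_inv u v : word_eq u v -> word_eq (word_inv u) (word_inv v).
Proof.
move=> Huv; have H1 := word_eq_ctx (word_inv u) (word_inv v) Huv.
have Hr : word_eq (word_inv u ++ v ++ word_inv v) (word_inv u).
  have := word_eq_cat (WordRefl (word_inv u)) (word_invr v).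
  by rewrite cats0.
have Hl : word_eq (word_inv u ++ u ++ word_inv v) (word_inv v).
  rewrite catA.
  exact: word_eq_cat (word_invl u) (WordRefl (word_inv v)).
exact: WordTrans (WordTrans (WordSym Hr) (WordSym H1)) Hl.
Qed.

Lemma presented_invE u : presented_inv (pword u) = pword (word_inv u).
Proof.
apply/(pword_eqE (word_inv _)).
by apply: word_eq_inv; apply: repr_pwordP.
Qed.

Lemma presented_oneE : presented_one = pword [::].
Proof. by []. Qed.

Lemma pwordW (P : presented -> Prop) :
  (forall u, P (pword u)) -> forall g, P g.
Proof. by move=> HP g; rewrite -[g]reprK; apply: HP. Qed.

Lemma presented_mulA : associative presented_mul.
Proof.
by elim/pwordW=> u; elim/pwordW=> v; elim/pwordW=> w; rewrite !presented_mulE catA.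
Qed.
Lemma presented_mul1 : left_id presented_one presented_mul.
Proof. by elim/pwordW=> u; rewrite presented_oneE presented_mulE. Qed.
Lemma presented_mul1r : right_id presented_one presented_mul.
Proof. by elim/pwordW=> u; rewrite presented_oneE presented_mulE cats0. Qed.
Lemma presented_mulV : left_inverse presented_one presented_inv presented_mul.
Proof.
elim/pwordW=> u; rewrite presented_oneE presented_invE presented_mulE.
by apply/pword_eqE; apply: word_invl.
Qed.
Lemma presented_mulVr : right_inverse presented_one presented_inv presented_mul.
Proof.
elim/pwordW=> u; rewrite presented_oneE presented_invE presented_mulE.
by apply/pword_eqE; apply: word_invr.
Qed.

HB.instance Definition _ := isGroup.Build presented
  presented_mulA presented_mul1 presented_mul1r presented_mulV presented_mulVr.

Definition pgen (i : I) : presented := pword [:: (i, false)].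

Lemma pword_cat u v : pword (u ++ v) = pword u * pword v.
Proof. by rewrite -presented_mulE. Qed.

Lemma pword_nil : pword [::] = 1.
Proof. by []. Qed.

Lemma pword_inv u : pword (word_inv u) = (pword u)^-1.
Proof. by rewrite -presented_invE. Qed.

Definition letter (G : groupType) (f : I -> G) (a : I * bool) : G :=
  if a.2 then (f a.1)^-1 else f a.1.

Definition word_val (G : groupType) (f : I -> G) (u : word I) : G :=
  \prod_(a <- u) letter f a.

Lemma pwordE u : pword u = word_val pgen u.
Proof.
elim: u => [|[i b] u IHu]; first by rewrite /word_val big_nil pword_nil.
rewrite /word_val big_cons -[_ :: u]cat1s pword_cat IHu /letter /=.
case: b => //; congr (_ * _).
by rewrite /pgen -pword_inv.
Qed.

Lemma presented_rel p : p \in rels -> word_val pgen p.1 = word_val pgen p.2.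
Proof.
move=> Hp; rewrite -!pwordE; apply/pword_eqE.
by have := WordRel [::] [::] Hp; rewrite /= !cats0.
Qed.

Lemma presented_lift (G : groupType) (f : I -> G) :
  (forall p, p \in rels -> word_val f p.1 = word_val f p.2) ->
  exists phi : {hom presented -> G}, forall i, phi (pgen i) = f i.
Proof.
move=> Hf.
have Hcat u v : word_val f (u ++ v) = word_val f u * word_val f v.
  by rewrite /word_val big_cat.
have Heq u v : word_eq u v -> word_val f u = word_val f v.
  elim=> {u v} [//|u v _ -> //|u v w _ -> _ -> //|u v i b|u v p Hp].
    rewrite !Hcat; congr (_ * _); rewrite -[RHS]mul1g; congr (_ * _).
    rewrite /word_val !big_cons big_nil mulg1 /letter /=.
    by case: b; rewrite ?mulVg ?mulgV.
  by rewrite !Hcat Hf.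
pose phi (g : presented) := word_val f (qrepr g).
have phiE u : phi (pword u) = word_val f u by apply/Heq/repr_pwordP.
have phiM : {morph phi : x y / x * y}.
  by elim/pwordW=> u; elim/pwordW=> v; rewrite -pword_cat !phiE Hcat.
have phi1 : phi 1 = 1 by rewrite -pword_nil phiE /word_val big_nil.
pose mphi : {hom presented -> G} :=
  HB.pack phi (isUMagmaMorphism.Build presented G phi (phi1, phiM)).
exists mphi => i; rewrite /= phiE /word_val big_seq1 /letter //.
Qed.

Definition plift (G : groupType) (f : I -> G)
    (Hf : forall p, p \in rels -> word_val f p.1 = word_val f p.2) :
  {hom presented -> G} := sval (cid (presented_lift Hf)).

Lemma pliftE (G : groupType) (f : I -> G) Hf i :
  @plift G f Hf (pgen i) = f i.
Proof. exact: (svalP (cid (presented_lift Hf))). Qed.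

Lemma presented_hom_eq (G : groupType) (phi psi : {hom presented -> G}) :
  (forall i, phi (pgen i) = psi (pgen i)) -> phi =1 psi.
Proof.
move=> Hpp; elim/pwordW=> u; rewrite pwordE /word_val !gmulf_prod.
by apply: eq_bigr => -[i [] _]; rewrite /letter /= ?gmulfV Hpp.
Qed.

End Presented.

Section Kernel.
Variables (G H : groupType) (phi : {hom G -> H}).

Definition ker_pred : {pred G} := [pred g | phi g == 1].

Lemma ker_closed : group_closed ker_pred.
Proof.
split=> [|x y]; rewrite !inE ?gmulf1 // => /eqP Hx /eqP Hy.
by rewrite gmulfM gmulfV Hx Hy invg1 mulg1.
Qed.

Lemma ker_normal x g : x \in Subgroup ker_closed -> x ^ g \in Subgroup ker_closed.
Proof. by rewrite !inE => /eqP Hx; rewrite gmulfJ Hx conj1g. Qed.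

Definition ker : normal_subgroup G := NormalSubgroup ker_normal.

Lemma kerP x : reflect (phi x = 1) (x \in ker).
Proof. exact: eqP. Qed.
End Kernel.

Lemma gen_sub (G : groupType) (S : G -> Prop) x : S x -> x \in gen S.
Proof. by move=> Sx; apply/asboolP => H; apply. Qed.

Lemma gen_min (G : groupType) (S : G -> Prop) (H : subgroup G) x :
  (forall y, S y -> y \in H) -> x \in gen S -> x \in H.
Proof. by move=> HS /asboolP; apply. Qed.

Definition zexpg (G : groupType) (g : G) (m : int) : G :=
  match m with Posz k => g ^+ k | Negz k => g ^- k.+1 end.

Definition gorder (G : groupType) (g : G) : nat :=
  match pselect (exists k, (0 < k) && (g ^+ k == 1)) with
  | left H => ex_minn H
  | right _ => 0
  end.

(* Two generators: false stands for r, true for s. *)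
Definition dihedral_rels (n : nat) : seq (word bool * word bool) :=
  [:: (nseq n (false, false), [::]);
      ([:: (true, false); (true, false)], [::]);
      ([:: (true, false); (false, false); (true, true); (false, false)], [::])].

Definition dihedral (n : nat) : groupType := presented (dihedral_rels n).
Definition dr (n : nat) : dihedral n := pgen (dihedral_rels n) false.
Definition ds (n : nat) : dihedral n := pgen (dihedral_rels n) true.

(* Two generators: false stands for sigma1, true for sigma2. *)
Definition B3_rels : seq (word bool * word bool) :=
  [:: ([:: (false, false); (true, false); (false, false)],
       [:: (true, false); (false, false); (true, false)])].

Definition B3 : groupType := presented B3_rels.
Definition sigma1 : B3 := pgen B3_rels false.
Definition sigma2 : B3 := pgen B3_rels true.

Definition x12 : B3 := sigma1 ^+ 2.
Definition x23 : B3 := sigma2 ^+ 2.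
Definition c : B3 := (sigma1 * sigma2 * sigma1) ^+ 2.

Definition o0 : 'I_3 := inord 0.
Definition o1 : 'I_3 := inord 1.
Definition o2 : 'I_3 := inord 2.

Lemma o_neq : [&& o0 != o1, o0 != o2 & o1 != o2].
Proof. by rewrite -!val_eqE /= !inordK. Qed.

Definition S3_gen (i : bool) : 'S_3 := if i then tperm o1 o2 else tperm o0 o1.

Lemma S3_braid :
  S3_gen false * S3_gen true * S3_gen false =
  S3_gen true * S3_gen false * S3_gen true.
Proof.
have /and3P[n01 n02 n12] := o_neq; rewrite /S3_gen.
have H : tperm o1 o2 ^ tperm o0 o1 = tperm o0 o1 ^ tperm o1 o2.
  by rewrite !tpermJ tpermR tpermL !tpermD // eq_sym.
by move: H; rewrite /conjg !tpermV !mulgA.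
Qed.

Lemma S3_rel p : p \in B3_rels -> word_val S3_gen p.1 = word_val S3_gen p.2.
Proof.
rewrite inE => /eqP -> /=.
by rewrite /word_val !big_cons !big_nil /letter /= !mulg1 !mulgA S3_braid.
Qed.

Definition B3_to_S3 : {hom B3 -> 'S_3} := plift S3_rel.

Definition PB3 : normal_subgroup B3 := ker B3_to_S3.

Lemma x12_PB3 : x12 \in PB3.
Proof. by apply/kerP; rewrite gmulfXn pliftE expg2 tperm2. Qed.

Lemma x23_PB3 : x23 \in PB3.
Proof. by apply/kerP; rewrite gmulfXn pliftE expg2 tperm2. Qed.

Lemma c_PB3 : c \in PB3.
Proof.
apply/kerP; rewrite gmulfXn !gmulfM !pliftE expg2 /S3_gen.
by rewrite !mulgA -(mulgA _ (tperm o0 o1) (tperm o0 o1)) tperm2 mulg1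
  -(mulgA _ (tperm o1 o2) (tperm o1 o2)) tperm2 mulg1 tperm2.
Qed.

(* Schreier rewriting for the subgroup PB3 of B3, with the coset representatives
   st_rep; it provides the homomorphisms out of PB3 and F2 used below. *)
Inductive st := Q0 | Q1 | Q2 | Q12 | Q21 | Q121.

Definition st_rep (s : st) : B3 :=
  match s with
  | Q0 => 1 | Q1 => sigma1 | Q2 => sigma2 | Q12 => sigma1 * sigma2
  | Q21 => sigma2 * sigma1 | Q121 => sigma1 * sigma2 * sigma1
  end.

Definition st_next (i : bool) (s : st) : st :=
  match i, s with
  | false, Q0 => Q1 | false, Q1 => Q0 | false, Q2 => Q21
  | false, Q21 => Q2 | false, Q12 => Q121 | false, Q121 => Q12
  | true, Q0 => Q2 | true, Q2 => Q0 | true, Q1 => Q12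
  | true, Q12 => Q1 | true, Q21 => Q121 | true, Q121 => Q21
  end.

Lemma st_nextK i : involutive (st_next i).
Proof. by case: i => -[]. Qed.

(* The value, for x12 |-> a, x23 |-> b, c |-> z with z central, of
   st_rep s * sigma_i * (st_rep (st_next i s))^-1. *)
Definition st_coc (G : groupType) (a b z : G) (i : bool) (s : st) : G :=
  match i, s with
  | false, Q1 => a | false, Q21 => a^-1 * z * b^-1 | false, Q121 => b
  | true, Q2 => b | true, Q12 => b^-1 * z * a^-1 | true, Q121 => a
  | _, _ => 1
  end.

Lemma braid : sigma1 * sigma2 * sigma1 = sigma2 * sigma1 * sigma2.
Proof.
have := @presented_rel _ B3_rels _ (mem_head _ _).
by rewrite /word_val !big_cons !big_nil /letter /= !mulg1 !mulgA.
Qed.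

Lemma braidA g : g * sigma1 * sigma2 * sigma1 = g * sigma2 * sigma1 * sigma2.
Proof. by rewrite -!mulgA; congr (_ * _); rewrite !mulgA braid. Qed.

Lemma c_eq0 : c = sigma2 * sigma1 * sigma2 * sigma2 * sigma1 * sigma2.
Proof.
by rewrite /c !expg2 !mulgA (braidA (sigma1 * sigma2 * sigma1)) braid.
Qed.

Lemma c_eq1 : sigma2 ^+ 2 * sigma1 * sigma2 ^+ 2 * sigma1 = c.
Proof.
rewrite c_eq0 !expg2 !mulgA -(braidA sigma2).
by rewrite (braidA (sigma2 * sigma1 * sigma2)).
Qed.

Lemma c_eq2 : sigma1 ^+ 2 * sigma2 * sigma1 ^+ 2 * sigma2 = c.
Proof. by rewrite c_eq0 !expg2 !mulgA (braidA sigma1) braid. Qed.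

Lemma st_cocE i s :
  st_rep s * pgen B3_rels i = st_coc x12 x23 c i s * st_rep (st_next i s).
Proof.
case: i s => -[] /=; rewrite -/sigma1 -/sigma2 ?mul1g ?mulg1 //.
- rewrite -c_eq1 /x12 /x23 !expg2 !invgM !mulgA.
  by rewrite !(mulgVK, mulVg, mul1g, mulgK).
- by rewrite braid.
- by rewrite /x12 expg2 !mulgA -(braidA sigma1).
- rewrite -c_eq2 /x12 /x23 !expg2 !invgM !mulgA.
  by rewrite !(mulgVK, mulVg, mul1g, mulgK).
- by rewrite /x23 expg2 !mulgA -(braidA sigma2) -braid.
Qed.

Definition st_next_letter (l : bool * bool) (s : st) : st := st_next l.1 s.

Definition st_coc_letter (G : groupType) (a b z : G) (l : bool * bool) (s : st) :=
  if l.2 then (st_coc a b z l.1 (st_next l.1 s))^-1 else st_coc a b z l.1 s.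

Fixpoint st_run (u : word bool) (s : st) : st :=
  if u is l :: u' then st_run u' (st_next_letter l s) else s.

Fixpoint st_val (G : groupType) (a b z : G) (u : word bool) (s : st) : G :=
  if u is l :: u' then
    st_coc_letter a b z l s * st_val a b z u' (st_next_letter l s)
  else 1.

Lemma st_run_cat u v s : st_run (u ++ v) s = st_run v (st_run u s).
Proof. by elim: u s => //= l u IHu s; rewrite IHu. Qed.

Lemma st_val_cat (G : groupType) (a b z : G) u v s :
  st_val a b z (u ++ v) s = st_val a b z u s * st_val a b z v (st_run u s).
Proof. by elim: u s => [s|l u IHu s] /=; rewrite ?mul1g // IHu mulgA. Qed.

Lemma st_run_eq u v : word_eq B3_rels u v -> st_run u =1 st_run v.
Proof.
elim=> {u v} [//|u v _ IH s|u v w _ IH1 _ IH2 s|u v i b s|u v p].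
- by rewrite IH.
- by rewrite IH1.
- by rewrite !st_run_cat /= /st_next_letter /= st_nextK.
- rewrite inE => /eqP -> s; rewrite !st_run_cat /=.
  by case: (st_run u s).
Qed.

Lemma st_val_eq (G : groupType) (a b : G) u v :
  word_eq B3_rels u v -> st_val a b 1 u =1 st_val a b 1 v.
Proof.
elim=> {u v} [//|u v _ IH s|u v w _ IH1 _ IH2 s|u v i b' s|u v p].
- by rewrite IH.
- by rewrite IH1.
- rewrite !st_val_cat /= /st_next_letter /st_coc_letter /= st_nextK.
  by case: b'; rewrite /= mulg1 ?mulVg ?mulgV mul1g.
- rewrite inE => /eqP -> s; rewrite !st_val_cat /=.
  rewrite /st_next_letter /st_coc_letter.
  case: (st_run u s); rewrite /= ?mul1g ?mulg1 //.
  - by rewrite mulgVK mulVKg.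
  - by rewrite mulgVK mulVKg.
  - by rewrite !mulgVK !mulgV.
Qed.

Lemma st_rep_run u s :
  st_rep s * pword B3_rels u = st_val x12 x23 c u s * st_rep (st_run u s).
Proof.
elim: u s => [|[i b] u IHu] s /=; first by rewrite pword_nil mulg1 mul1g.
rewrite -cat1s pword_cat mulgA -[RHS]mulgA -IHu [RHS]mulgA; congr (_ * _).
rewrite /st_coc_letter /st_next_letter /=; case: b; last exact: st_cocE.
rewrite -[(i, true)]/(i, ~~ false) -[[:: _]]/(word_inv [:: (i, false)]).
rewrite pword_inv; have := st_cocE i (st_next i s).
rewrite st_nextK -/(pgen _ _) => H.
by apply: (mulIg (pgen B3_rels i)); rewrite mulgVK -mulgA H mulKg.
Qed.

Definition st_perm (s : st) : 'S_3 := B3_to_S3 (st_rep s).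

Lemma st_perm1 s : st_perm s = 1 -> s = Q0.
Proof.
have /and3P[n01 n02 n12] := o_neq.
rewrite /st_perm; case: s => //=; rewrite ?gmulfM !pliftE /S3_gen => /permP.
- by move/(_ o0); rewrite perm1 tpermL => /esym/eqP; rewrite (negPf n01).
- by move/(_ o1); rewrite perm1 tpermL => /esym/eqP; rewrite (negPf n12).
- move/(_ o0); rewrite perm1 permM tpermL tpermL => /esym/eqP.
  by rewrite (negPf n02).
- move/(_ o1); rewrite perm1 permM tpermL tpermD // => /esym/eqP.
  by rewrite (negPf n12).
- move/(_ o0); rewrite perm1 !permM !tpermL tpermD // => /esym/eqP.
  by rewrite (negPf n02).
Qed.

Lemma st_coc_in (G : groupType) (S : subgroup G) (a b z : G) i s :
  a \in S -> b \in S -> z \in S -> st_coc a b z i s \in S.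
Proof.
move=> Sa Sb Sz; have [S1 _] := sg_closed S.
have SM := group_closedM (sg_closed S); have SV := group_closedV (sg_closed S).
by case: i s => -[] //=; apply: (SM); rewrite ?SV //; apply: (SM); rewrite ?SV.
Qed.

Lemma st_val_in (G : groupType) (S : subgroup G) (a b z : G) u s :
  a \in S -> b \in S -> z \in S -> st_val a b z u s \in S.
Proof.
move=> Sa Sb Sz; have [S1 _] := sg_closed S.
have SM := group_closedM (sg_closed S); have SV := group_closedV (sg_closed S).
elim: u s => //= -[i b'] u IHu s; apply: SM => //.
by rewrite /st_coc_letter; case: (_.2); rewrite ?SV ?st_coc_in.
Qed.

Definition PB3_generators : B3 -> Prop := fun g => [\/ g = x12, g = x23 | g = c].

Lemma st_val_gen u s : st_val x12 x23 c u s \in gen PB3_generators.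
Proof.
by apply: st_val_in; apply: gen_sub; [constructor 1|constructor 2|constructor 3].
Qed.

Lemma st_run_PB3 u : (pword B3_rels u \in PB3) -> st_run u Q0 = Q0.
Proof.
move=> /kerP Hu; apply: st_perm1; rewrite /st_perm.
have := st_rep_run u Q0; rewrite mul1g => /(congr1 B3_to_S3).
rewrite Hu gmulfM => H.
suff /kerP Hv : st_val x12 x23 c u Q0 \in PB3 by rewrite H Hv mul1g.
apply: gen_min (st_val_gen u Q0) => g [] ->.
- exact: x12_PB3.
- exact: x23_PB3.
- exact: c_PB3.
Qed.

Lemma PB3_gen g :
  g \in PB3 -> g \in gen PB3_generators.
Proof.
elim/pwordW: g => u Hu; have := st_rep_run u Q0.
by rewrite (st_run_PB3 Hu) mul1g mulg1 => ->; apply: st_val_gen.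
Qed.

Lemma st_run_repr g : g \in PB3 ->
  st_run (qrepr g) Q0 = Q0.
Proof.
move=> Hg; apply: st_run_PB3.
by rewrite (_ : pword _ _ = g) //; apply: reprK.
Qed.

Definition px12 : PB3 := exist _ x12 x12_PB3.
Definition px23 : PB3 := exist _ x23 x23_PB3.
Definition pc : PB3 := exist _ c c_PB3.

Lemma PB3_hom_exists (G : groupType) (a b : G) :
  exists phi : {hom PB3 -> G}, [/\ phi px12 = a, phi px23 = b & phi pc = 1].
Proof.
pose phi (g : PB3) : G := st_val a b 1 (qrepr (val g)) Q0.
have phiE u (Hu : pword B3_rels u \in PB3) :
  phi (exist _ (pword B3_rels u) Hu) = st_val a b 1 u Q0.
  by apply: st_val_eq; apply: repr_pwordP.
have phiV (g : PB3) u : val g = pword B3_rels u -> phi g = st_val a b 1 u Q0.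
  by move=> Hg; rewrite /phi Hg; apply: st_val_eq; apply: repr_pwordP.
have phiM : {morph phi : g h / g * h}.
  move=> g h; rewrite (phiV _ (qrepr (val g) ++ qrepr (val h))).
    by rewrite st_val_cat st_run_repr // (valP g).
  rewrite valM pword_cat; congr (_ * _); apply/esym; exact: reprK.
have phi1 : phi 1 = 1 by rewrite (phiV 1 [::]).
pose mphi : {hom PB3 -> G} :=
  HB.pack phi (isUMagmaMorphism.Build PB3 G phi (phi1, phiM)).
exists mphi; split; rewrite /=.
- rewrite (phiV _ [:: (false, false); (false, false)]) /=.
    by rewrite /st_coc_letter /= mul1g mulg1.
  by rewrite /x12 expg2 -pword_cat.
- rewrite (phiV _ [:: (true, false); (true, false)]) /=.
    by rewrite /st_coc_letter /= mul1g mulg1.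
  by rewrite /x23 expg2 -pword_cat.
- pose d := [:: (false, false); (true, false); (false, false)].
  rewrite (phiV _ (d ++ d)) /=.
    by rewrite /st_coc_letter /= !mul1g !mulg1 mulgVK mulgV.
  have Hd : pword B3_rels d = sigma1 * sigma2 * sigma1.
    by rewrite pwordE /word_val !big_cons big_nil /letter /= mulg1 mulgA.
  by rewrite -[RHS]/(pword B3_rels (d ++ d)) pword_cat Hd /c expg2.
Qed.

Definition PB3_of (g : B3) (Hg : g \in PB3) : PB3 := exist _ g Hg.

Lemma PB3_hom_eq (G : groupType) (phi psi : {hom PB3 -> G}) :
  phi px12 = psi px12 -> phi px23 = psi px23 -> phi pc = psi pc -> phi =1 psi.
Proof.
move=> H1 H2 H3 g.
pose P : {pred B3} := [pred x | `[< forall Hx : x \in PB3,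
  phi (PB3_of Hx) = psi (PB3_of Hx) >] && (x \in PB3)].
have Pc : group_closed P.
  split=> [|x y]; rewrite !inE.
    apply/andP; split; last exact: nsg1.
    apply/asboolP=> Hx; rewrite (_ : PB3_of _ = 1); last exact: val_inj.
    by rewrite !gmulf1.
  move=> /andP[/asboolP Hx Px] /andP[/asboolP Hy Py].
  have Pxy : x * y^-1 \in PB3 by apply: nsgM; last exact: nsgV.
  apply/andP; split=> //; apply/asboolP=> Hxy.
  rewrite (_ : PB3_of _ = PB3_of Px * (PB3_of Py)^-1); last first.
    by apply: val_inj; rewrite gmulfF.
  by rewrite !gmulfF Hx Hy.
have Pgen x : PB3_generators x -> x \in Subgroup Pc.
  rewrite !inE; case=> ->; apply/andP; split.
  - apply/asboolP => Hx; rewrite (_ : PB3_of _ = px12) //; exact: val_inj.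
  - exact: x12_PB3.
  - apply/asboolP => Hx; rewrite (_ : PB3_of _ = px23) //; exact: val_inj.
  - exact: x23_PB3.
  - apply/asboolP => Hx; rewrite (_ : PB3_of _ = pc) //; exact: val_inj.
  - exact: c_PB3.
have := gen_min Pgen (PB3_gen (valP g)).
rewrite inE => /andP[/asboolP/(_ (valP g)) + _].
by rewrite (_ : PB3_of _ = g) //; exact: val_inj.
Qed.

Definition F2 : subgroup B3 := gen (fun g => g = x12 \/ g = x23).

Lemma x12_F2 : x12 \in F2. Proof. by apply: gen_sub; left. Qed.
Lemma x23_F2 : x23 \in F2. Proof. by apply: gen_sub; right. Qed.

Definition Fx : F2 := exist _ x12 x12_F2.
Definition Fy : F2 := exist _ x23 x23_F2.

Lemma F2_sub_PB3 g : g \in F2 -> g \in PB3.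
Proof. by apply: gen_min => _ [] ->; [apply: x12_PB3 | apply: x23_PB3]. Qed.

Definition F2_PB3 (f : F2) : PB3 := exist _ (val f) (F2_sub_PB3 (valP f)).

Lemma F2_PB3M : {morph F2_PB3 : f g / f * g}.
Proof. by move=> f g; apply: val_inj. Qed.
Lemma F2_PB31 : F2_PB3 1 = 1.
Proof. exact: val_inj. Qed.
HB.instance Definition _ := isUMagmaMorphism.Build F2 PB3 F2_PB3
  (F2_PB31, F2_PB3M).

Lemma F2_hom_exists (G : groupType) (a b : G) :
  exists phi : {hom F2 -> G}, phi Fx = a /\ phi Fy = b.
Proof.
have [phi [Ha Hb _]] := PB3_hom_exists a b.
exists (phi \o F2_PB3); rewrite /= -Ha -Hb.
by split; congr (phi _); apply: val_inj.
Qed.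

(* Determined by E_spec, since Fx and Fy generate F2. *)
Definition E (m : int) (f : F2) : {hom F2 -> F2} :=
  sval (cid (F2_hom_exists (zexpg Fx (2 * m + 1)%R)
                           (f^-1 * zexpg Fy (2 * m + 1)%R * f))).

Lemma E_spec m f : E m f Fx = zexpg Fx (2 * m + 1)%R /\
                   E m f Fy = f^-1 * zexpg Fy (2 * m + 1)%R * f.
Proof. exact: (svalP (cid (F2_hom_exists _ _))). Qed.

Definition dihedral3 (n : nat) : groupType :=
  (dihedral n * dihedral n * dihedral n)%type.

(* Determined by psi_spec, see PB3_hom_eq. *)
Definition psi (n : nat) : {hom PB3 -> dihedral3 n} :=
  sval (cid (PB3_hom_exists
    (dr n, ds n, ds n : dihedral n) (dr n * ds n, dr n, dr n * ds n))).

Lemma psi_spec n :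
  [/\ psi n px12 = (dr n, ds n, ds n),
      psi n px23 = (dr n * ds n, dr n, dr n * ds n) & psi n pc = 1].
Proof. exact: (svalP (cid (PB3_hom_exists _ _))). Qed.

Definition K_pred (n : nat) : {pred B3} :=
  [pred g | `[< exists2 h : PB3, val h = g & psi n h = 1 >]].

Lemma K_closed n : group_closed (K_pred n).
Proof.
split=> [|x y].
  by apply/asboolP; exists 1; rewrite ?gmulf1.
move=> /asboolP[x' <- Hx] /asboolP[y' <- Hy]; apply/asboolP.
by exists (x' * y'^-1); rewrite gmulfF // Hx Hy divgg.
Qed.

Section DihedralFacts.
Variable n : nat.
Let r := dr n.
Let s := ds n.

Lemma word_val_nseq (G : groupType) (f : bool -> G) k :
  word_val f (nseq k (false, false)) = f false ^+ k.
Proof.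
by rewrite /word_val; elim: k => [|k IHk]; rewrite ?big_nil //= big_cons IHk expgS.
Qed.

Lemma dihedral_hom_exists (G : groupType) (a b : G) :
  a ^+ n = 1 -> b * b = 1 -> b * a = a^-1 * b ->
  exists phi : {hom dihedral n -> G}, phi r = a /\ phi s = b.
Proof.
move=> Ha Hb Hba.
pose f (i : bool) := if i then b else a.
have Hf p : p \in dihedral_rels n -> word_val f p.1 = word_val f p.2.
  rewrite !inE => /or3P[] /eqP -> /=.
  - by rewrite word_val_nseq /word_val big_nil.
  - by rewrite /word_val !big_cons !big_nil /letter /= mulg1.
  - rewrite /word_val !big_cons !big_nil /letter /= mulg1 !mulgA Hba.
    by rewrite mulgK mulVg.
by exists (plift Hf); split; rewrite pliftE.
Qed.

Lemma dih_rn : r ^+ n = 1.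
Proof.
have := @presented_rel _ (dihedral_rels n) _ (mem_head _ _).
by rewrite /= word_val_nseq /word_val big_nil.
Qed.

Lemma dih_ss : s * s = 1.
Proof.
have := @presented_rel _ (dihedral_rels n) ([:: (true, false); (true, false)], [::]).
rewrite !inE eqxx orbT => /(_ isT).
by rewrite /word_val !big_cons !big_nil /letter /= mulg1.
Qed.

Lemma dih_sV : s^-1 = s.
Proof. exact: mulg1_eq dih_ss. Qed.

Lemma dih_sr : s * r = r^-1 * s.
Proof.
have := @presented_rel _ (dihedral_rels n)
  ([:: (true, false); (false, false); (true, true); (false, false)], [::]).
rewrite !inE eqxx !orbT => /(_ isT).
rewrite /word_val !big_cons !big_nil /letter /= mulg1 !mulgA => H.
apply: (mulIg s^-1); rewrite mulgK; apply: (mulIg r); rewrite mulVg.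
exact: H.
Qed.

Lemma dih_srV : s * r^-1 = r * s.
Proof. by apply: (mulIg r); rewrite mulgVK -mulgA dih_sr mulVKg. Qed.

Lemma dih_endo a b : a \in [:: r; r^-1] -> b \in [:: s; r * s; r ^+ 2 * s] ->
  exists phi : {hom dihedral n -> dihedral n}, phi r = a /\ phi s = b.
Proof.
move=> Ha Hb; apply: dihedral_hom_exists.
- by move: Ha; rewrite !inE => /orP[] /eqP ->; rewrite ?expVgn dih_rn ?invg1.
- move: Hb; rewrite !inE => /or3P[] /eqP ->; rewrite ?dih_ss //.
  + by rewrite -mulgA (mulgA s) dih_sr -!mulgA dih_ss mulg1 mulgV.
  + rewrite expg2 !mulgA -(mulgA _ s r) dih_sr !mulgA mulgK.
    by rewrite -(mulgA _ s r) dih_sr !mulgA mulgV mul1g dih_ss.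
- have Hbr : b * r = r^-1 * b.
    move: Hb; rewrite !inE => /or3P[] /eqP ->; rewrite ?dih_sr //.
    + by rewrite -mulgA dih_sr mulKg mulVKg.
    + by rewrite expg2 -mulgA dih_sr !mulgA mulgK mulVg mul1g.
  move: Ha; rewrite !inE => /orP[] /eqP -> //.
  apply: (mulIg r); rewrite mulgVK invgK -mulgA Hbr; exact: esym (mulVKg _ _).
Qed.
End DihedralFacts.

Section KNormal.
Variable n : nat.
Let r := dr n.
Let s := ds n.

Lemma KP (h : PB3) : (val h \in K_pred n) <-> psi n h = 1.
Proof.
split=> [/asboolP[h' /val_inj -> //]|Hh].
by apply/asboolP; exists h.
Qed.

Lemma K_conj_PB3 (h : PB3) x : x \in K_pred n -> x ^ val h \in K_pred n.
Proof.
move=> /asboolP[x' <- Hx]; apply/asboolP; exists (x' ^ h).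
  by rewrite gmulfJ.
by rewrite gmulfJ Hx conj1g.
Qed.

Section Conj.
Variable g : B3.
Definition PB3_conj (h : PB3) : PB3 := PB3_of (nsg_normal g (valP h)).
Lemma PB3_conjM : {morph PB3_conj : x y / x * y}.
Proof. by move=> x y; apply: val_inj; rewrite /= conjMg. Qed.
Lemma PB3_conj1 : PB3_conj 1 = 1.
Proof. by apply: val_inj; rewrite /= conj1g. Qed.
HB.instance Definition _ := isUMagmaMorphism.Build PB3 PB3 PB3_conj
  (PB3_conj1, PB3_conjM).
End Conj.

Lemma c_central : c * sigma1 = sigma1 * c /\ c * sigma2 = sigma2 * c.
Proof.
pose d := sigma1 * sigma2 * sigma1.
have d1 : d * sigma1 = sigma2 * d by rewrite /d !mulgA -braid.
have d2 : d * sigma2 = sigma1 * d by rewrite /d !mulgA (braidA sigma1).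
rewrite -/d /c -/d expg2; split.
  by rewrite -[LHS]mulgA d1 [LHS]mulgA d2 -[LHS]mulgA.
by rewrite -[LHS]mulgA d2 [LHS]mulgA d1 -[LHS]mulgA.
Qed.

Definition trip_map (f1 f2 f3 : {hom dihedral n -> dihedral n})
    (sw : dihedral3 n -> dihedral3 n) (d : dihedral3 n) : dihedral3 n :=
  (f1 (sw d).1.1, f2 (sw d).1.2, f3 (sw d).2).

Lemma psi_conj (g : B3) (f1 f2 f3 : {hom dihedral n -> dihedral n})
    (sw : dihedral3 n -> dihedral3 n) :
  {morph sw : x y / x * y} -> sw 1 = 1 ->
  psi n (PB3_conj g px12) = trip_map f1 f2 f3 sw (psi n px12) ->
  psi n (PB3_conj g px23) = trip_map f1 f2 f3 sw (psi n px23) ->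
  PB3_conj g pc = pc ->
  forall h, psi n h = 1 -> psi n (PB3_conj g h) = 1.
Proof.
move=> swM sw1 Hx Hy Hc h Hh.
have tM : {morph trip_map f1 f2 f3 sw : x y / x * y}.
  by move=> x y; rewrite /trip_map swM !gmulfM.
have t1 : trip_map f1 f2 f3 sw 1 = 1 by rewrite /trip_map sw1 !gmulf1.
pose th : {hom dihedral3 n -> dihedral3 n} :=
  HB.pack (trip_map f1 f2 f3 sw) (isUMagmaMorphism.Build (dihedral3 n)
    (dihedral3 n) (trip_map f1 f2 f3 sw) (t1, tM)).
have := @PB3_hom_eq _ (psi n \o PB3_conj g) (th \o psi n) _ _ _ h.
rewrite /= Hh t1; apply=> //.
have [_ _ P3] := psi_spec n.
by rewrite Hc P3 t1.
Qed.

Lemma psi_conj_sigma1 (h : PB3) : psi n h = 1 -> psi n (PB3_conj sigma1^-1 h) = 1.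
Proof.
have [P1 P2 P3] := psi_spec n; have [c1 c2] := c_central.
have [al1 [ar1 as1]] : exists phi : {hom dihedral n -> dihedral n},
  phi r = r /\ phi s = r * s by apply: dih_endo; rewrite !inE eqxx ?orbT.
have [al2 [ar2 as2]] : exists phi : {hom dihedral n -> dihedral n},
  phi r = r^-1 /\ phi s = s by apply: dih_endo; rewrite !inE eqxx ?orbT.
apply: (@psi_conj _ al1 al2 idfun (fun d => (d.1.1, d.2, d.1.2))) => //.
- rewrite (_ : PB3_conj _ _ = px12); last first.
    by apply: val_inj; rewrite /= /conjg invgK /x12 expg2 !mulgA mulgK.
  by rewrite P1 /trip_map /= ar1 as2.
- rewrite (_ : PB3_conj _ _ = px23^-1 * pc * px12^-1); last first.
    apply: val_inj; rewrite !gmulfM !gmulfV /= /conjg invgK.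
    have := st_cocE true Q12; rewrite /= => H.
    by apply: (mulIg sigma1); rewrite -H /x23 expg2 !mulgA mulgVK.
  rewrite !gmulfM !gmulfV P1 P2 P3 mulg1 /trip_map /= gmulfM ar1 as1.
  rewrite gmulfM ar2 as2.
  rewrite P2; congr (_, _, _).
  + change ((r * s)^-1 * r^-1 = r * (r * s)).
    by rewrite invgM dih_sV dih_srV -mulgA dih_srV.
  + change (r^-1 * s^-1 = r^-1 * s).
    by rewrite dih_sV.
  + change ((r * s)^-1 * s^-1 = r).
    by rewrite invgM dih_sV dih_srV -mulgA dih_ss mulg1.
- by apply: val_inj; rewrite /= /conjg invgK /= mulgA -c1 mulgK.
Qed.

Lemma psi_conj_sigma2 (h : PB3) : psi n h = 1 -> psi n (PB3_conj sigma2^-1 h) = 1.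
Proof.
have [P1 P2 P3] := psi_spec n; have [c1 c2] := c_central.
have [al2 [ar2 as2]] : exists phi : {hom dihedral n -> dihedral n},
  phi r = r /\ phi s = r * s by apply: dih_endo; rewrite !inE eqxx ?orbT.
have [al3 [ar3 as3]] : exists phi : {hom dihedral n -> dihedral n},
  phi r = r^-1 /\ phi s = r ^+ 2 * s by apply: dih_endo; rewrite !inE eqxx ?orbT.
apply: (@psi_conj _ idfun al2 al3 (fun d => (d.2, d.1.2, d.1.1))) => //.
- rewrite (_ : PB3_conj _ _ = px12^-1 * pc * px23^-1); last first.
    apply: val_inj; rewrite !gmulfM !gmulfV /= /conjg invgK.
    have := st_cocE false Q21; rewrite /= => H.
    by apply: (mulIg sigma2); rewrite -H /x12 expg2 !mulgA mulgVK.
  rewrite !gmulfM !gmulfV P1 P3 mulg1 /trip_map /= as2 ar3.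
  rewrite ?P1 P2; congr (_, _, _).
  + change (r^-1 * (r * s)^-1 = s).
    by rewrite invgM dih_sV dih_srV mulKg.
  + change (s^-1 * r^-1 = r * s).
    by rewrite dih_sV dih_srV.
  + change (s^-1 * (r * s)^-1 = r^-1).
    by rewrite invgM dih_sV mulgA dih_ss mul1g.
- rewrite (_ : PB3_conj _ _ = px23); last first.
    by apply: val_inj; rewrite /= /conjg invgK /x23 expg2 !mulgA mulgK.
  rewrite P2 /trip_map /= ar2 gmulfM ar3 as3.
  by rewrite expg2 -mulgA mulKg.
- by apply: val_inj; rewrite /= /conjg invgK /= mulgA -c2 mulgK.
Qed.

Lemma K_sub_PB3 x : x \in K_pred n -> x \in PB3.
Proof. by move=> /asboolP[y <- _]; apply: valP. Qed.

Lemma K_conjV (g : B3) x :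
  (forall h, psi n h = 1 -> psi n (PB3_conj g h) = 1) ->
  x \in K_pred n -> x ^ g \in K_pred n.
Proof.
by move=> Hg /asboolP[y <- /Hg Hy]; apply/asboolP; exists (PB3_conj g y).
Qed.

Lemma K_conj (x g : B3) : x \in K_pred n -> x ^ g \in K_pred n.
Proof.
rewrite -[g]invgK; move: {g}(g^-1) x; elim/pwordW=> u; rewrite pwordE.
have Hgen i b x : x \in K_pred n ->
    x ^ (letter (pgen B3_rels) (i, b))^-1 \in K_pred n.
  have HV y : y \in K_pred n -> y ^ (pgen B3_rels i)^-1 \in K_pred n.
    by case: i; apply: K_conjV; [apply: psi_conj_sigma2 | apply: psi_conj_sigma1].
  rewrite /letter /=; case: b => //= Hx; last exact: HV.
  have Hp : pgen B3_rels i ^+ 2 \in PB3.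
    by case: i {HV}; [apply: x23_PB3 | apply: x12_PB3].
  have := K_conj_PB3 (PB3_of Hp) (HV _ Hx).
  by rewrite /= -conjgM expg2 mulKg invgK.
elim: u => [|[i b] u IHu] x Hx; rewrite /word_val ?big_nil ?big_cons.
  by rewrite invg1 conjg1.
by rewrite invgM conjgM; apply: Hgen; apply: IHu.
Qed.
End KNormal.

Definition K (n : nat) : normal_subgroup B3 :=
  @NormalSubgroup B3 (Subgroup (K_closed n)) (@K_conj n).

Definition finite_index (G : groupType) (N : normal_subgroup G) : Prop :=
  exists s : seq (quot N), forall q, q \in s.

Definition NFI (N : normal_subgroup B3) : Prop :=
  {subset N <= PB3} /\ finite_index N.

Lemma dihedral_finite (n : nat) : 0 < n ->
  exists e : seq (dihedral n), forall d, d \in e.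
Proof.
move=> n_gt0; pose r := dr n; pose s := ds n.
exists [seq r ^+ i * s ^+ j | i <- iota 0 n, j <- iota 0 2] => d.
suff [k [j ->]] : exists k j : nat, d = r ^+ k * s ^+ j.
  have -> : r ^+ k = r ^+ (k %% n).
    by rewrite {1}(divn_eq k n) mulnC expgnDr expgnA dih_rn expg1n mul1g.
  have -> : s ^+ j = s ^+ (j %% 2).
    by rewrite {1}(divn_eq j 2) mulnC expgnDr expgnA [s ^+ 2]dih_ss expg1n mul1g.
  by apply: allpairs_f; rewrite mem_iota ltn_mod.
have rV : r^-1 = r ^+ n.-1.
  by apply: mulg1_eq; rewrite -expgS prednK // dih_rn.
have sr k : s * r ^+ k = r ^- k * s.
  elim: k => [|k IHk]; first by rewrite invg1 mulg1 mul1g.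
  by rewrite expgSr mulgA IHk -mulgA dih_sr mulgA invgM -expVgn -expgSr -expgS expVgn.
elim/pwordW: d => u; rewrite pwordE.
elim: u => [|[i b] u [k [j IHu]]]; rewrite /word_val ?big_nil ?big_cons.
  by exists 0, 0; rewrite mulg1.
rewrite -/(word_val _ u) IHu /letter /=.
have Hs : s * (r ^+ k * s ^+ j) = r ^+ (n.-1 * k) * s ^+ j.+1.
  by rewrite mulgA sr -expVgn rV -expgnA -mulgA -expgS.
case: i; [exists (n.-1 * k)%N, j.+1 | case: b].
- by rewrite -Hs; case: b; rewrite ?dih_sV.
- by exists (n.-1 + k)%N, j; rewrite -/r rV mulgA -expgnDr.
- by exists k.+1, j; rewrite mulgA -expgS.
Qed.

Lemma K_NFI (n : nat) : 0 < n -> NFI (K n).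
Proof.
move=> n_gt0; split; first by move=> x; apply: K_sub_PB3.
have [e He] := dihedral_finite n_gt0.
pose pick_psi d : B3 :=
  if pselect (exists h, psi n h = d) is left H then val (sval (cid H)) else 1.
pose sts := [:: Q0; Q1; Q2; Q12; Q21; Q121].
exists [seq in_quot (K n) (pick_psi p * t)
  | p <- [seq (p, c) | p <- [seq (a, b) | a <- e, b <- e], c <- e], t <- map st_rep sts].
elim/quotW=> g; elim/pwordW: g => u.
have := st_rep_run u Q0; rewrite mul1g => ->.
have Hv : st_val x12 x23 c u Q0 \in PB3.
  apply: st_val_in; [exact: x12_PB3 | exact: x23_PB3 | exact: c_PB3].
move: (st_run u Q0) (st_val _ _ _ _ _) Hv => t v Hv.
apply/allpairsP; exists (psi n (PB3_of Hv), st_rep t); split.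
- case: (psi n _) => -[d1 d2] d3 /=.
  by apply/allpairsP; exists ((d1, d2), d3); split=> //=; apply: allpairs_f.
- by case: t; rewrite !inE eqxx ?orbT.
rewrite /= !gmulfM; congr (_ * _); apply/in_quot_eqE.
rewrite /pick_psi; case: pselect => [H|[]]; last by exists (PB3_of Hv).
case: (cid H) => h Hh /=.
have : psi n ((PB3_of Hv)^-1 * (h : PB3)) = 1.
  by rewrite gmulfM gmulfV Hh mulVg.
by move/KP.
Qed.

Section Shadows.
Variable N : normal_subgroup B3.

(* The orders are taken in B3 / N, of which PB3 / N is a subgroup. *)
Definition Nord : nat :=
  lcmn (lcmn (gorder (in_quot N x12)) (gorder (in_quot N x23)))
       (gorder (in_quot N c)).

Definition NF2_pred : {pred F2} := [pred f | val f \in N].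

Lemma NF2_closed : group_closed NF2_pred.
Proof.
split=> [|x y]; first exact: nsg1.
by rewrite !inE => Hx Hy; apply: nsgM; last exact: nsgV.
Qed.

Lemma NF2_normal (x g : F2) :
  x \in Subgroup NF2_closed -> x ^ g \in Subgroup NF2_closed.
Proof. by rewrite !inE gmulfJ => Hx; apply: nsg_normal. Qed.

Definition NF2 : normal_subgroup F2 := NormalSubgroup NF2_normal.

(* Z / Nord x F2 / NF2; a class in Z / Nord is represented by its least
   nonnegative element (Nord > 0 when N has finite index). *)
Definition shadow : Type := (int * quot NF2)%type.

Definition mk_shadow (m : int) (f : F2) : shadow :=
  ((m %% Nord)%Z, in_quot NF2 f).

Definition hexagons (m : int) (f0 : F2) : Prop :=
  let f := val f0 in let u := (2 * m + 1)%R in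
  in_quot N (zexpg sigma1 u * f^-1 * zexpg sigma2 u * f) =
    in_quot N (f^-1 * sigma1 * sigma2 * zexpg x12 (- m)%R * zexpg c m) /\
  in_quot N (f^-1 * zexpg sigma2 u * f * zexpg sigma1 u) =
    in_quot N (sigma2 * sigma1 * zexpg x23 (- m)%R * zexpg c m * f).

Definition is_T (m : int) (f : F2) (T : {hom B3 -> quot N}) : Prop :=
  T sigma1 = in_quot N (zexpg sigma1 (2 * m + 1)%R) /\
  T sigma2 = in_quot N ((val f)^-1 * zexpg sigma2 (2 * m + 1)%R * val f).

Definition GT_cond (m : int) (f : F2) : Prop :=
  [/\ hexagons m f,
      coprimez (2 * m + 1)%R Nord,
      in_quot NF2 f \in derived (quot NF2)
    & exists2 T, is_T m f T & forall q, exists g, T g = q].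

Definition GT_pred : {pred shadow} :=
  [pred s | `[< exists m f, s = mk_shadow m f /\ GT_cond m f >]].

Definition GT : Type := {s : shadow | s \in GT_pred}.

Definition isolated : Prop :=
  NFI N /\
  forall m f T, GT_cond m f -> is_T m f T -> forall g, T g = 1 <-> g \in N.

Definition is_group_law (A : Type) (op : A -> A -> A) : Prop :=
  associative op /\
  exists2 e : A, left_id e op /\ right_id e op
    & forall a, exists2 b, op a b = e & op b a = e.

(* op is the composition of GT(N): it is given by the formula below on all
   representatives of the classes, and it makes GT(N) a group. *)
Definition GT_composition (op : GT -> GT -> GT) : Prop :=
  (forall (s1 s2 : GT) m1 f1 m2 f2,
     val s1 = mk_shadow m1 f1 -> val s2 = mk_shadow m2 f2 ->
     val (op s1 s2) =
       mk_shadow (2 * m1 * m2 + m1 + m2)%R (f1 * E m1 f1 f2)) /\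
  is_group_law op.

End Shadows.

Section Semidirect.
Variable n1 : nat.

(* Z/n1 x| (Z/2n)^x for n1 >= 2 and n = 2 n1: the modulus 2 * (2 * n1) is 2n,
   written in terms of n1 so that reduction modulo n1 is always defined. *)
Definition Zsd : Type := ('Z_n1 * {unit 'Z_(2 * (2 * n1))})%type.
HB.instance Definition _ := Finite.on Zsd.

Definition Zred (u : {unit 'Z_(2 * (2 * n1))}) : 'Z_n1 :=
  ((val u : nat)%:R)%R.

Definition Zsd_mul (p q : Zsd) : Zsd :=
  ((p.1 + Zred p.2 * q.1)%R, p.2 * q.2).
Definition Zsd_one : Zsd := (0%R, 1).
Definition Zsd_inv (p : Zsd) : Zsd := ((- (Zred p.2^-1 * p.1))%R, p.2^-1).

Lemma Zmod_dvd : (Zp_trunc n1).+2 %| (Zp_trunc (2 * (2 * n1))).+2.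
Proof.
case: n1 => [|[|m]] //; rewrite (@Zp_cast (2 * (2 * m.+2))) //.
by rewrite Zp_cast // mulnA dvdn_mull.
Qed.

Lemma Zred1 : Zred 1 = 1%R.
Proof. by []. Qed.

Lemma ZredM u v : Zred (u * v) = (Zred u * Zred v)%R.
Proof.
rewrite /Zred -GRing.natrM /= !Zp_nat; apply: val_inj => /=.
by rewrite modn_dvdm // Zmod_dvd.
Qed.

Lemma Zsd_mulA : associative Zsd_mul.
Proof.
move=> p q t; rewrite /Zsd_mul /= ZredM mulgA.
by rewrite GRing.mulrDr GRing.mulrA GRing.addrA.
Qed.
Lemma Zsd_mul1 : left_id Zsd_one Zsd_mul.
Proof.
by case=> a u; rewrite /Zsd_mul /= Zred1 GRing.add0r GRing.mul1r mul1g.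
Qed.
Lemma Zsd_mulV : left_inverse Zsd_one Zsd_inv Zsd_mul.
Proof. by case=> a u; rewrite /Zsd_mul /Zsd_inv /= GRing.addNr mulVg. Qed.

HB.instance Definition _ :=
  Finite_isGroup.Build Zsd Zsd_mulA Zsd_mul1 Zsd_mulV.
End Semidirect.

Definition kappa (m : int) : int :=
  if (m %% 2)%Z == 1%R then (m + 1)%R else (- m)%R.

(* Only meant for odd u. *)
Definition nu (u : int) : int :=
  if (u %% 4)%Z == 1%R then ((u - 1)%R %/ 4)%Z else ((u + 1)%R %/ 4)%Z.

(* For n1 even, the condition does not depend on the integers representing
   p.1 modulo n1 and p.2 modulo 4 * n1. *)
Definition Hsub (n1 : nat) : {set Zsd n1} :=
  [set p : Zsd n1 |
    (Posz (p.1 : nat) == nu (Posz (val p.2 : nat)) %[mod 2])%Z].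

(* p is the value at s of the formula
   (m, (r^(2k), r^(-2k), r^kappa(m))) |-> (k + n1 Z, (2m+1) + 2n Z);
   a class f N_{F2} is identified with psi_n(f). *)
Definition rho_formula (n : nat) (s : GT (K n)) (p : Zsd n./2) : Prop :=
  exists (m k : int) (f : F2),
    [/\ (0 <= m < n%:Z)%R,
        val s = mk_shadow (K n) m f,
        psi n (F2_PB3 f) = (zexpg (dr n) (2 * k)%R, zexpg (dr n) (- (2 * k))%R,
                            zexpg (dr n) (kappa m)),
        p.1 = (k%:~R)%R
      & val p.2 = ((2 * m + 1)%:~R)%R].

(* Main.v *)
(* An element (m, f) is governed by m and F = psi_n(f).  When f is in the
   derived subgroup, F = (r^a, r^b, r^c), and conjugation by sigma1 and sigma2
   acts on psi_n(PB3) by permuting and twisting the three coordinates, so the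
   hexagon relations become congruences modulo n: c = kappa(m) and a + b = 0.
   The derived subgroup of psi_n(F2) consists of the (r^2x, r^2y, r^2z) with
   x = y = z mod 2, which gives the condition on k.  On psi_n, both T_{m,f} and
   E_{m,f} act by an endomorphism theta of D_n^3, injective because 2m+1 is
   prime to n; hence ker T = K.  In these coordinates the composition is
   (k1, u1)(k2, u2) = (k1 + u1 k2, u1 u2) with u = 2m+1, the third coordinate
   matching because 1 - 2 kappa(m) = u or - u according to the parity of m. *)
Require Import Defs.
From HB Require Import structures.
From mathcomp Require Import all_boot all_order all_algebra all_fingroup.
From mathcomp Require Import boolp.
From mathcomp Require Import zify.

Set Implicit Arguments.
Unset Strict Implicit.
Unset Printing Implicit Defensive.

Import GroupScope.
Local Open Scope group_scope.

(** * Integer powers and normal forms in dihedral groups *)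

Section Zexpg.
Variable G : groupType.
Implicit Types (g : G) (m p : int).

(** Every integer is a difference of two naturals, so identities on integer exponents reduce to
    natural ones without case analysis on signs. *)
Lemma zexpgB g (a b : nat) : zexpg g (a%:Z - b%:Z)%R = g ^+ a * g ^- b.
Proof.
case: (leqP b a) => ab.
  rewrite (_ : (_ - _)%R = Posz (a - b)%N) /=; last by lia.
  by rewrite -{2}(subnK ab) expgnDr mulgK.
rewrite (_ : (_ - _)%R = Negz (b - a).-1) /=; last by lia.
rewrite prednK ?subn_gt0 // -{2}(subnKC (ltnW ab)) expgnDr invgM.
have H : commute (g ^- a) (g ^- (b - a)).
  by apply: commuteV; apply/commute_sym/commuteV/commuteX2.
by rewrite -H mulVKg.
Qed.

Lemma zexpgD g m p : zexpg g (m + p)%R = zexpg g m * zexpg g p.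
Proof.
have Hint (x : int) : exists a b : nat, x = (a%:Z - b%:Z)%R.
  by case: x => k; [exists k, 0%N | exists 0%N, k.+1]; lia.
have [a [b ->]] := Hint m; have [a' [b' ->]] := Hint p.
rewrite (_ : (_ + _)%R = ((a + a')%N%:Z - (b + b')%N%:Z)%R); last by lia.
rewrite !zexpgB expgnDr (addnC b) expgnDr invgM.
have H : commute (g ^+ a') (g ^- b) by apply/commuteV/commuteX2.
by rewrite -!mulgA; congr (_ * _); rewrite !mulgA H.
Qed.

Lemma zexpgN g m : zexpg g (- m)%R = (zexpg g m)^-1.
Proof. by apply: (mulgI (zexpg g m)); rewrite -zexpgD GRing.subrr mulgV. Qed.

Lemma zexpgM g m p : zexpg g (m * p)%R = zexpg (zexpg g m) p.
Proof.
have Hn (k : nat) : zexpg g (m * k%:Z)%R = zexpg g m ^+ k.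
  elim: k => [|k IHk]; first by rewrite GRing.mulr0.
  by rewrite expgSr -IHk -zexpgD; congr zexpg; lia.
case: p => k; first exact: Hn.
by rewrite NegzE GRing.mulrN !zexpgN Hn.
Qed.

Lemma zexpgJ g h m : zexpg g m ^ h = zexpg (g ^ h) m.
Proof. by case: m => k /=; rewrite ?conjVg conjXg. Qed.
End Zexpg.

Lemma gmulf_zexpg (G H : groupType) (phi : {hom G -> H}) g m :
  phi (zexpg g m) = zexpg (phi g) m.
Proof. by case: m => k /=; rewrite ?gmulfV gmulfXn. Qed.

Lemma zexpg_pair (G H : groupType) (p : (G * H)%type) m :
  zexpg p m = (zexpg p.1 m, zexpg p.2 m).
Proof.
have Hn k : p ^+ k = (p.1 ^+ k, p.2 ^+ k).
  by elim: k => // k IHk; rewrite !expgS IHk.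
by case: m => k /=; rewrite Hn.
Qed.

(** The bound on d matters: for d = 0 or 1 the type ['Z_d] is Z/2. *)
Lemma Zp_int_eq d (a b : int) : 1 < d ->
  (a%:~R = b%:~R :> 'Z_d)%R <-> (d %| (a - b)%R)%Z.
Proof.
move=> d_gt1.
have natr0 (k : nat) : (k%:R == 0 :> 'Z_d)%R = (d %| k).
  by rewrite -(Zp_nat_mod d_gt1) -val_eqE /= val_Zp_nat // modn_mod.
have intr0 (x : int) : (x%:~R == 0 :> 'Z_d)%R = (d %| x)%Z.
  rewrite dvdzE -natr0; case: x => k //=.
  by rewrite NegzE mulrNz GRing.oppr_eq0.
by rewrite -intr0 mulrzBr GRing.subr_eq0; split=> [->|/eqP].
Qed.

(** Conjugation by s^i multiplies the exponents of r by this sign, (-1)^i. *)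
Definition signed (i : bool) (a : int) : int := if i then (- a)%R else a.

Section Dih.
Variable n : nat.

(** The normal form r^a s^i. The exponent stays an integer, so that products and inverses become
    integer arithmetic for [lia]; reduction modulo n enters only through [dih_eqP]. *)
Definition dih (a : int) (i : bool) : dihedral n := zexpg (dr n) a * ds n ^+ i.

Lemma dih_r a : zexpg (dr n) a = dih a false.
Proof. by rewrite /dih mulg1. Qed.

Lemma drE : dr n = dih 1 false. Proof. by rewrite -dih_r. Qed.
Lemma dsE : ds n = dih 0 true. Proof. by rewrite /dih mul1g. Qed.
Lemma dih1 : dih 0 false = 1. Proof. by rewrite -dih_r. Qed.

Lemma ds_zexpg (i : bool) a :
  ds n ^+ i * zexpg (dr n) a = zexpg (dr n) (signed i a) * ds n ^+ i.
Proof.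
case: i; last by rewrite mul1g mulg1.
have Hn (k : nat) : ds n * dr n ^+ k = dr n ^- k * ds n.
  elim: k => [|k IHk]; first by rewrite invg1 mulg1 mul1g.
  by rewrite expgSr mulgA IHk -mulgA dih_sr mulgA invgM -!expVgn -expgSr -expgS.
rewrite /= expg1; case: a => k; first by rewrite zexpgN /= Hn.
rewrite NegzE GRing.opprK /=; apply: (mulIg (dr n ^+ k.+1)).
by rewrite mulgVK -mulgA Hn mulVKg.
Qed.

Lemma dihM a i b j : dih a i * dih b j = dih (a + signed i b)%R (i (+) j).
Proof.
rewrite /dih mulgA -(mulgA (zexpg _ a)) ds_zexpg mulgA -zexpgD -mulgA.
by congr (_ * _); case: i; case: j; rewrite ?mul1g ?mulg1 //= dih_ss.
Qed.

Lemma dihV a i : (dih a i)^-1 = dih (signed (~~ i) a) i.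
Proof.
apply: (mulgI (dih a i)); rewrite mulgV dihM addbb -dih1; congr dih.
by case: i => /=; lia.
Qed.

Lemma dih_surj d : exists a i, d = dih a i.
Proof.
elim/pwordW: d => u; rewrite pwordE.
elim: u => [|[g b] u [a [i IHu]]]; rewrite /word_val ?big_nil ?big_cons.
  by exists 0%R, false; rewrite dih1.
rewrite -/(word_val _ u) IHu /letter /=.
rewrite -/(dr n) -/(ds n); case: g b => -[]; rewrite -/(dr n) -/(ds n) ?drE ?dsE;
  by rewrite ?dihV dihM; eexists; eexists.
Qed.

Lemma zexpg_rn a : zexpg (dr n) (a * n%:Z)%R = 1.
Proof.
by rewrite GRing.mulrC zexpgM /= dih_rn; case: a => k /=; rewrite expg1n ?invg1.
Qed.

(* The model of the dihedral group used here is the action on Z/n by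
   x |-> x + 1 and x |-> - x. *)
Lemma dih_eqP a i b j : 2 < n ->
  dih a i = dih b j <-> i = j /\ (n %| (a - b)%R)%Z.
Proof.
move=> n_gt2; split=> [|[-> /dvdzP[q Hq]]]; last first.
  rewrite (_ : a = b + q * n%:Z)%R; last by rewrite -Hq; lia.
  by rewrite /dih zexpgD zexpg_rn mulg1.
have n_gt1 : 1 < n by lia.
pose rot := perm (@GRing.addIr 'Z_n 1%R).
pose ref := perm (@GRing.oppr_inj 'Z_n).
have rotX k x : (rot ^+ k) x = (x + k%:R)%R.
  elim: k x => [|k IHk] x; first by rewrite perm1 GRing.addr0.
  by rewrite expgSr permM IHk permE GRing.mulrSr GRing.addrA.
have [||| phi [phir phis]] := @dihedral_hom_exists n {perm 'Z_n} rot ref.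
- apply/permP=> x; rewrite rotX perm1 (_ : n%:R = 0)%R ?GRing.addr0 //.
  by apply/(Zp_int_eq n 0 n_gt1); rewrite GRing.subr0 dvdzz.
- by apply/permP=> x; rewrite permM !permE GRing.opprK.
- apply: (mulgI rot); rewrite mulVKg; apply/permP=> x; rewrite !permM !permE.
  by rewrite GRing.opprD GRing.subrK.
have rotZ (e : int) x : (zexpg rot e) x = (x + e%:~R)%R.
  case: e => k; first by rewrite rotX.
  apply: (canLR (permK _)); rewrite rotX NegzE mulrNz.
  exact: esym (GRing.subrK _ _).
have phiE e k x : phi (dih e k) x = ((signed k (Posz 1))%:~R * (x + e%:~R))%R.
  rewrite /dih gmulfM gmulf_zexpg phir permM rotZ; case: k.
    by rewrite phis permE /= GRing.mulN1r.
  by rewrite gmulf1 perm1 GRing.mul1r.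
move=> /(congr1 phi) /permP H.
(* Subtracting the values at 0 from those at 1 leaves the two signs, and 1 differs from -1 modulo n
   as n > 2. *)
have Hij : i = j.
  have := H 1%R; have := H 0%R; rewrite !phiE !GRing.mulrDr !GRing.mulr0 !GRing.add0r.
  move=> -> /GRing.addIr; rewrite !GRing.mulr1 => /(Zp_int_eq _ _ n_gt1).
  by case: i {H} => //; case: j => //; rewrite dvdzE gtnNdvd.
split=> //; have := H 0%R; rewrite Hij !phiE !GRing.add0r.
move=> H0; apply/(Zp_int_eq a b n_gt1); case: j {H Hij} H0 => /=.
  by rewrite mulrNz !GRing.mulN1r => /GRing.oppr_inj.
by rewrite !GRing.mul1r.
Qed.
End Dih.
Arguments dih n a%_R i.

(** * The action of the braid generators on psi *)

Section Aff.
Variable n : nat.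

(** The elements r^u and r^t s satisfy the relations of D_n, because every r^t s is an involution
    inverting the rotations. *)
Lemma aff_exists (u t : int) : exists phi : {hom dihedral n -> dihedral n},
  forall a i, phi (dih n a i) = dih n (u * a + t * i%:Z)%R i.
Proof.
have [||| phi [phir phis]] :=
  @dihedral_hom_exists n (dihedral n) (dih n u false) (dih n t true).
- have -> : dih n u false ^+ n = zexpg (dih n u false) n by [].
  by rewrite -!dih_r -zexpgM zexpg_rn.
- by rewrite dihM -dih1; congr dih => /=; lia.
- by rewrite dihV !dihM; congr dih => /=; lia.
exists phi => a i; rewrite {1}/dih gmulfM gmulf_zexpg phir.
rewrite -dih_r -zexpgM dih_r gmulfXn phis.
case: i; rewrite ?mulg1 ?dihM /= ?GRing.mulr0 ?GRing.addr0 //; congr dih; lia.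
Qed.

Definition aff (u t : int) : {hom dihedral n -> dihedral n} := sval (cid (aff_exists u t)).
Arguments aff u%_R t%_R.

Lemma affE u t a i : aff u t (dih n a i) = dih n (u * a + t * i%:Z)%R i.
Proof. exact: (svalP (cid (aff_exists u t))). Qed.

Lemma trip_hom_exists (f1 f2 f3 : {hom dihedral n -> dihedral n})
    (sw : dihedral3 n -> dihedral3 n) :
  {morph sw : x y / x * y} -> sw 1 = 1 ->
  exists th : {hom dihedral3 n -> dihedral3 n}, forall d, th d = trip_map f1 f2 f3 sw d.
Proof.
move=> swM sw1.
have tM : {morph trip_map f1 f2 f3 sw : x y / x * y}.
  by move=> x y; rewrite /trip_map swM !gmulfM.
have t1 : trip_map f1 f2 f3 sw 1 = 1 by rewrite /trip_map sw1 !gmulf1.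
pose th : {hom dihedral3 n -> dihedral3 n} :=
  HB.pack (trip_map f1 f2 f3 sw) (isUMagmaMorphism.Build (dihedral3 n)
    (dihedral3 n) (trip_map f1 f2 f3 sw) (t1, tM)).
by exists th.
Qed.

Definition trip a1 i1 a2 i2 a3 i3 : dihedral3 n := (dih n a1 i1, dih n a2 i2, dih n a3 i3).
Arguments trip a1%_R i1 a2%_R i2 a3%_R i3.

Lemma trip_surj d : exists a1 i1 a2 i2 a3 i3, d = trip a1 i1 a2 i2 a3 i3.
Proof.
case: d => -[d1 d2] d3.
have [a1 [i1 ->]] := dih_surj d1; have [a2 [i2 ->]] := dih_surj d2.
by have [a3 [i3 ->]] := dih_surj d3; exists a1, i1, a2, i2, a3, i3.
Qed.

Lemma tripM a1 i1 a2 i2 a3 i3 b1 j1 b2 j2 b3 j3 :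
  trip a1 i1 a2 i2 a3 i3 * trip b1 j1 b2 j2 b3 j3 =
  trip (a1 + signed i1 b1) (i1 (+) j1) (a2 + signed i2 b2) (i2 (+) j2)
       (a3 + signed i3 b3) (i3 (+) j3).
Proof. by rewrite /trip -!dihM. Qed.

Lemma tripV a1 i1 a2 i2 a3 i3 :
  (trip a1 i1 a2 i2 a3 i3)^-1 =
  trip (signed (~~ i1) a1) i1 (signed (~~ i2) a2) i2 (signed (~~ i3) a3) i3.
Proof. by rewrite /trip -!dihV. Qed.

Lemma trip1 : trip 0 false 0 false 0 false = 1.
Proof. by rewrite /trip dih1. Qed.

Lemma psi_x12 : psi n px12 = trip 1 false 0 true 0 true.
Proof. by have [-> _ _] := psi_spec n; rewrite /trip -dsE -drE. Qed.

Lemma psi_x23 : psi n px23 = trip 1 true 1 false 1 true.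
Proof. by have [_ -> _] := psi_spec n; rewrite /trip -drE drE dsE dihM. Qed.

Lemma psi_c : psi n pc = 1.
Proof. by have [] := psi_spec n. Qed.

(* PB3_conj g h is g^-1 h g, so this is the action of h |-> sigma1 h sigma1^-1. *)
Lemma psi_conj1 h a1 i1 a2 i2 a3 i3 : psi n h = trip a1 i1 a2 i2 a3 i3 ->
  psi n (PB3_conj sigma1^-1 h) =
  trip (a1 + i1) i1 (- a3) i3 a2 i2.
Proof.
have [th thE] := @trip_hom_exists (aff 1 1) (aff (- 1) 0) idfun
  (fun d => (d.1.1, d.2, d.1.2)) (fun _ _ => erefl) erefl.
have thT b1 j1 b2 j2 b3 j3 : th (trip b1 j1 b2 j2 b3 j3) =
    trip (b1 + j1) j1 (- b3) j3 b2 j2.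
  by rewrite thE /trip_map /= !affE !GRing.mul1r GRing.mulN1r GRing.mul0r GRing.addr0.
(* [H23] amounts to sigma1 x23 sigma1^-1 = x23^-1 c x12^-1. *)
have [c1 _] := c_central; have H23 := st_cocE true Q12.
have := @PB3_hom_eq _ (psi n \o PB3_conj sigma1^-1) (th \o psi n) _ _ _ h.
rewrite /= => -> => [->//|||]; rewrite ?psi_x12 ?psi_x23 ?thT.
- rewrite -psi_x12; congr (psi n _); apply: val_inj.
  by rewrite /= /conjg invgK /x12 expg2 !mulgA mulgK.
- rewrite (_ : PB3_conj _ _ = px23^-1 * pc * px12^-1).
    by rewrite !gmulfM !gmulfV psi_x12 psi_x23 psi_c mulg1 !tripV tripM; congr trip.
  apply: val_inj; rewrite !gmulfM !gmulfV /= /conjg invgK.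
  by apply: (mulIg sigma1); rewrite -[RHS]H23 /x23 expg2 !mulgA mulgVK.
- rewrite psi_c gmulf1 -[RHS]psi_c; congr (psi n _); apply: val_inj.
  by rewrite /= /conjg invgK /= mulgA -c1 mulgK.
Qed.

(** Both sides are homomorphisms in h, so they are compared at x12, x23 and c only; conjugation by
    sigma2 swaps the outer coordinates, up to a twist. *)
Lemma psi_conj2 h a1 i1 a2 i2 a3 i3 : psi n h = trip a1 i1 a2 i2 a3 i3 ->
  psi n (PB3_conj sigma2^-1 h) =
  trip a3 i3 (a2 + i2) i2 (- a1 + 2 * i1%:Z) i1.
Proof.
have [th thE] := @trip_hom_exists idfun (aff 1 1) (aff (- 1) 2)
  (fun d => (d.2, d.1.2, d.1.1)) (fun _ _ => erefl) erefl.
have thT b1 j1 b2 j2 b3 j3 : th (trip b1 j1 b2 j2 b3 j3) =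
    trip b3 j3 (b2 + j2) j2 (- b1 + 2 * j1%:Z) j1.
  by rewrite thE /trip_map [LHS]/= !affE !GRing.mul1r GRing.mulN1r.
have [_ c2] := c_central; have H12 := st_cocE false Q21.
have := @PB3_hom_eq _ (psi n \o PB3_conj sigma2^-1) (th \o psi n) _ _ _ h.
rewrite /= => -> => [->//|||]; rewrite ?psi_x12 ?psi_x23 ?thT.
- rewrite (_ : PB3_conj _ _ = px12^-1 * pc * px23^-1).
    by rewrite !gmulfM !gmulfV psi_x12 psi_x23 psi_c mulg1 !tripV tripM; congr trip.
  apply: val_inj; rewrite !gmulfM !gmulfV /= /conjg invgK.
  by apply: (mulIg sigma2); rewrite -[RHS]H12 /x12 expg2 !mulgA mulgVK.
- rewrite -psi_x23; congr (psi n _); apply: val_inj.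
  by rewrite /= /conjg invgK /x23 expg2 !mulgA mulgK.
- rewrite psi_c gmulf1 -[RHS]psi_c; congr (psi n _); apply: val_inj.
  by rewrite /= /conjg invgK /= mulgA -c2 mulgK.
Qed.
End Aff.
Arguments trip n a1%_R i1 a2%_R i2 a3%_R i3.

(** * The hexagon relations *)

Lemma sigma1_odd m : zexpg sigma1 (2 * m + 1)%R = zexpg x12 m * sigma1.
Proof. by rewrite zexpgD zexpgM. Qed.

Lemma sigma2_odd m : zexpg sigma2 (2 * m + 1)%R = zexpg x23 m * sigma2.
Proof. by rewrite zexpgD zexpgM. Qed.

Lemma commute_zexpg (G : groupType) (g h : G) m : commute g h -> commute g (zexpg h m).
Proof. by case: m => k H /=; [apply: commuteX | apply/commuteV/commuteX]. Qed.

Lemma c_commute g : commute g c.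
Proof.
have [c1 c2] := c_central; apply: commute_sym.
elim/pwordW: g => u; rewrite pwordE; elim: u => [|[i b] u IHu].
  by rewrite /word_val big_nil; apply: commute1.
rewrite /word_val big_cons; apply: commuteM => //.
by rewrite /letter; case: b; case: i => //=; apply: commuteV.
Qed.

Lemma zexpg_intertwine (G : groupType) (g x y : G) k :
  g * x = y * g -> g * zexpg x k = zexpg y k * g.
Proof.
move=> H; apply: (mulIg g^-1); rewrite mulgK.
have -> : y = x ^ g^-1 by rewrite /conjg invgK mulgA H mulgK.
by rewrite -zexpgJ /conjg invgK mulgA.
Qed.

Lemma x12_sigma12 : sigma1 * sigma2 * x12 = x23 * (sigma1 * sigma2).
Proof. by rewrite /x12 /x23 !expg2 !mulgA braid (braidA sigma2). Qed.

Lemma x23_sigma21 : sigma2 * sigma1 * x23 = x12 * (sigma2 * sigma1).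
Proof. by rewrite /x12 /x23 !expg2 !mulgA -braid -(braidA sigma1). Qed.

Lemma val_zexpg (S : subgroup B3) (h : S) m : val (zexpg h m) = zexpg (val h) m.
Proof. exact: (gmulf_zexpg (val : {hom S -> B3})). Qed.

Section Hexagons.
Variable n : nat.

(** As psi is defined on PB3 only, cosets in B3 are compared after writing them as an element of PB3
    times a common right factor t. *)
Lemma K_cosetP (p q : PB3) (t : B3) :
  in_quot (K n) (val p * t) = in_quot (K n) (val q * t) <-> psi n p = psi n q.
Proof.
have H : in_quot (K n) (val p) = in_quot (K n) (val q) <-> psi n p = psi n q.
  rewrite in_quot_eqE (_ : _^-1 * _ = val (p^-1 * q)) // KP gmulfM gmulfV.
  split=> [H|->]; last by rewrite mulVg.
  by apply: (mulgI (psi n p)^-1); rewrite H mulVg.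
by rewrite -H !in_quotM; split=> [/mulIg|->].
Qed.

(** All sigma's are moved to the right, turning the elements of PB3 that they cross into conjugates.
    The two sides of the first relation then end in sigma1 sigma2, those of the second in sigma2
    sigma1, and [K_cosetP] applies. *)
Lemma hexagonsP m (f : F2) : let F := F2_PB3 f in
  let a1 := PB3_conj sigma1^-1 in let a2 := PB3_conj sigma2^-1 in
  hexagons (K n) m f <->
  psi n (zexpg px12 m * a1 (F^-1 * zexpg px23 m) * a1 (a2 F)) =
    psi n (F^-1 * zexpg px23 (- m)) /\
  psi n (F^-1 * zexpg px23 m * a2 (F * zexpg px12 m)) =
    psi n (zexpg px12 (- m) * a2 (a1 F)).
Proof.
move=> F a1 a2; rewrite /hexagons.
have cz g : commute g (zexpg c m) by apply/commute_zexpg/c_commute.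
have vx k : sval (zexpg px12 k) = zexpg x12 k by exact: val_zexpg.
have vy k : sval (zexpg px23 k) = zexpg x23 k by exact: val_zexpg.
have vc k : sval (zexpg pc k) = zexpg c k by exact: val_zexpg.
have l1 : zexpg sigma1 (2 * m + 1)%R * (val f)^-1 * zexpg sigma2 (2 * m + 1)%R * val f =
    val (zexpg px12 m * a1 (F^-1 * zexpg px23 m) * a1 (a2 F)) * (sigma1 * sigma2).
  rewrite sigma1_odd sigma2_odd !valM /= vx vy /conjg !invgK !mulgA.
  by rewrite !(mulgVK, mulgK).
have r1 : (val f)^-1 * sigma1 * sigma2 * zexpg x12 (- m)%R * zexpg c m =
    val (F^-1 * zexpg px23 (- m) * zexpg pc m) * (sigma1 * sigma2).
  rewrite !valM /= vy vc -!mulgA; congr (_ * _).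
  by rewrite (mulgA sigma1) (mulgA (sigma1 * _)) (zexpg_intertwine _ x12_sigma12)
    -(mulgA _ (_ * _)) cz.
have l2 : (val f)^-1 * zexpg sigma2 (2 * m + 1)%R * val f * zexpg sigma1 (2 * m + 1)%R =
    val (F^-1 * zexpg px23 m * a2 (F * zexpg px12 m)) * (sigma2 * sigma1).
  rewrite sigma1_odd sigma2_odd !valM /= vx vy /conjg !invgK !mulgA.
  by rewrite !(mulgVK, mulgK).
have r2 : sigma2 * sigma1 * zexpg x23 (- m)%R * zexpg c m * val f =
    val (zexpg px12 (- m) * zexpg pc m * a2 (a1 F)) * (sigma2 * sigma1).
  rewrite !valM /= vx vc /conjg !invgK !mulgA !(mulgVK, mulgK).
  by rewrite (zexpg_intertwine _ x23_sigma21) -(mulgA _ (sigma2 * _) (zexpg c m)) cz !mulgA.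
rewrite l1 r1 l2 r2 !K_cosetP.
(* The powers of c drop out because psi kills c. *)
have pz : psi n (zexpg pc m) = 1.
  by rewrite gmulf_zexpg psi_c; case: (m) => k /=; rewrite expg1n ?invg1.
have e1 p : psi n (p * zexpg pc m) = psi n p by rewrite gmulfM pz mulg1.
have e2 p q : psi n (p * zexpg pc m * q) = psi n (p * q) by rewrite gmulfM e1 -gmulfM.
by rewrite e1 e2.
Qed.
End Hexagons.

Lemma int_parity (m : int) : exists p : int, m = (2 * p)%R \/ m = (2 * p + 1)%R.
Proof. by exists (m %/ 2)%Z; lia. Qed.

Lemma kappa_even p : kappa (2 * p)%R = (- (2 * p))%R.
Proof. by rewrite /kappa; case: eqP; lia. Qed.

Lemma kappa_odd p : kappa (2 * p + 1)%R = (2 * p + 2)%R.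
Proof. by rewrite /kappa; case: eqP; lia. Qed.

(** * The hexagon relations for triples of rotations *)

Section Rotations.
Variable n : nat.

Lemma trip_eqP a1 i1 a2 i2 a3 i3 b1 j1 b2 j2 b3 j3 : 2 < n ->
  trip n a1 i1 a2 i2 a3 i3 = trip n b1 j1 b2 j2 b3 j3 <->
  [/\ i1 = j1, i2 = j2, i3 = j3 &
      [/\ (n %| (a1 - b1)%R)%Z, (n %| (a2 - b2)%R)%Z & (n %| (a3 - b3)%R)%Z]].
Proof.
move=> n_gt2; split=> [|[-> -> -> []]].
  by case=> /dih_eqP[]// -> H1 /dih_eqP[]// -> H2 /dih_eqP[]// -> H3.
by move=> H1 H2 H3; congr (_, _, _); apply/dih_eqP.
Qed.

Lemma zexpg_dih a k : zexpg (dih n a false) k = dih n (a * k) false.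
Proof. by rewrite -!dih_r -zexpgM. Qed.

Lemma zexpg_dih_even a k : zexpg (dih n a true) (2 * k) = 1.
Proof.
rewrite zexpgM /= expg2 dihM GRing.subrr addbb dih1.
by case: k => k /=; rewrite expg1n ?invg1.
Qed.

Lemma zexpg_dih_odd a k : zexpg (dih n a true) (2 * k + 1) = dih n a true.
Proof. by rewrite zexpgD zexpg_dih_even mul1g. Qed.

Lemma zexpg_trip a1 i1 a2 i2 a3 i3 k : zexpg (trip n a1 i1 a2 i2 a3 i3) k =
  (zexpg (dih n a1 i1) k, zexpg (dih n a2 i2) k, zexpg (dih n a3 i3) k).
Proof. by rewrite !zexpg_pair. Qed.

Lemma psiM x y : psi n (x * y) = psi n x * psi n y. Proof. exact: gmulfM. Qed.
Lemma psiV x : psi n x^-1 = (psi n x)^-1. Proof. exact: gmulfV. Qed.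

Lemma psi_x12_even p : psi n (zexpg px12 (2 * p)) = trip n (2 * p) false 0 false 0 false.
Proof.
rewrite gmulf_zexpg psi_x12 zexpg_trip !zexpg_dih_even zexpg_dih GRing.mul1r.
by rewrite /trip dih1.
Qed.

Lemma psi_x12_odd p :
  psi n (zexpg px12 (2 * p + 1)) = trip n (2 * p + 1) false 0 true 0 true.
Proof. by rewrite gmulf_zexpg psi_x12 zexpg_trip !zexpg_dih_odd zexpg_dih GRing.mul1r. Qed.

Lemma psi_x23_even p : psi n (zexpg px23 (2 * p)) = trip n 0 false (2 * p) false 0 false.
Proof.
rewrite gmulf_zexpg psi_x23 zexpg_trip !zexpg_dih_even zexpg_dih GRing.mul1r.
by rewrite /trip dih1.
Qed.

Lemma psi_x23_odd p :
  psi n (zexpg px23 (2 * p + 1)) = trip n 1 true (2 * p + 1) false 1 true.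
Proof. by rewrite gmulf_zexpg psi_x23 zexpg_trip !zexpg_dih_odd zexpg_dih GRing.mul1r. Qed.

Lemma dvdz_lin (d x y z : int) : (d %| x)%Z -> (d %| y)%Z ->
  (exists s t, z = (s * x + t * y)%R) -> (d %| z)%Z.
Proof. by move=> dx dy [s [t ->]]; apply: GRing.rpredD; apply: dvdz_mull. Qed.

(** The divisibilities met below are combinations of two known ones with coefficients -1, 0 or 1;
    all nine pairs are tried. *)
Ltac dvdz_comb H1 H2 :=
  apply: (dvdz_lin H1 H2);
  first [ by exists 1%R, 0%R; lia | by exists 0%R, 1%R; lia | by exists (- 1)%R, 0%R; lia
        | by exists 0%R, (- 1)%R; lia | by exists 1%R, 1%R; lia | by exists 1%R, (- 1)%R; lia
        | by exists (- 1)%R, 1%R; lia | by exists (- 1)%R, (- 1)%R; lia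
        | by exists 0%R, 0%R; lia ].

(** The parity of m decides whether x12^m and x23^m have reflection coordinates. In both cases the
    first two coordinates of the first hexagon give the two congruences, and these imply every
    coordinate of both hexagons. *)
Lemma hexagons_rot m (f : F2) a b c : 2 < n ->
  psi n (F2_PB3 f) = trip n a false b false c false ->
  hexagons (K n) m f <-> (n %| (c - kappa m)%R)%Z /\ (n %| (a + b)%R)%Z.
Proof.
move=> n_gt2 Ff; rewrite hexagonsP.
have [p [->|->]] := int_parity m.
- rewrite kappa_even -GRing.mulrN.
  have := psiM ((F2_PB3 f)^-1) (zexpg px23 (2 * p)).
  rewrite psiV Ff psi_x23_even tripV tripM => E1.
  have := psiM (F2_PB3 f) (zexpg px12 (2 * p)).
  rewrite Ff psi_x12_even tripM => E2.
  rewrite !psiM !psiV (psi_conj1 E1) (psi_conj1 (psi_conj2 Ff)) (psi_conj2 E2).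
  rewrite (psi_conj2 (psi_conj1 Ff)) Ff !psi_x12_even !psi_x23_even !tripV !tripM !trip_eqP //=.
  split=> [[[_ _ _ [H1 H2 _]] _]|[H1 H2]]; first by split; dvdz_comb H1 H2.
  by split; split=> //; split; dvdz_comb H1 H2.
- rewrite kappa_odd (_ : - (2 * p + 1) = 2 * (- p - 1) + 1)%R; last by lia.
  have := psiM ((F2_PB3 f)^-1) (zexpg px23 (2 * p + 1)).
  rewrite psiV Ff psi_x23_odd tripV tripM => E1.
  have := psiM (F2_PB3 f) (zexpg px12 (2 * p + 1)).
  rewrite Ff psi_x12_odd tripM => E2.
  rewrite !psiM !psiV (psi_conj1 E1) (psi_conj1 (psi_conj2 Ff)) (psi_conj2 E2).
  rewrite (psi_conj2 (psi_conj1 Ff)) Ff !psi_x12_odd !psi_x23_odd !tripV !tripM !trip_eqP //=.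
  split=> [[[_ _ _ [H1 H2 _]] _]|[H1 H2]]; first by split; dvdz_comb H1 H2.
  by split; split=> //; split; dvdz_comb H1 H2.
Qed.
End Rotations.

(** * The derived subgroup *)

(** The elements satisfying P form a subgroup containing the generators, and [gen] is the least such
    subgroup. *)
Lemma F2_ind (P : F2 -> Prop) : P 1 -> P Fx -> P Fy ->
  (forall f g, P f -> P g -> P (f * g^-1)) -> forall f, P f.
Proof.
move=> P1 Px Py PM f.
pose S : {pred B3} := [pred g | `[< exists2 h : F2, val h = g & P h >]].
have Sc : group_closed S.
  split=> [|x y]; rewrite !inE; first by apply/asboolP; exists 1.
  move=> /asboolP[x' <- Hx] /asboolP[y' <- Hy]; apply/asboolP.
  by exists (x' * y'^-1); [rewrite gmulfF | apply: PM].
have : val f \in Subgroup Sc.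
  apply: gen_min (valP f) => _ [] ->; apply/asboolP.
    by exists Fx.
  by exists Fy.
by move=> /asboolP[h /val_inj ->].
Qed.

Section Derived.
Variable n : nat.

Lemma psiF_M f g : psi n (F2_PB3 (f * g)) = psi n (F2_PB3 f) * psi n (F2_PB3 g).
Proof. by rewrite !gmulfM. Qed.

Lemma psiF_V f : psi n (F2_PB3 f^-1) = (psi n (F2_PB3 f))^-1.
Proof. by rewrite !gmulfV. Qed.

Lemma psiF_Z f k : psi n (F2_PB3 (zexpg f k)) = zexpg (psi n (F2_PB3 f)) k.
Proof. by rewrite !gmulf_zexpg. Qed.

Lemma F2_PB3_x : F2_PB3 Fx = px12. Proof. exact: val_inj. Qed.
Lemma F2_PB3_y : F2_PB3 Fy = px23. Proof. exact: val_inj. Qed.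

(** This is the identification of the quotient of F2 with a subgroup of D_n^3. *)
Lemma NF2_cosetP f g : in_quot (NF2 (K n)) f = in_quot (NF2 (K n)) g <->
  psi n (F2_PB3 f) = psi n (F2_PB3 g).
Proof.
rewrite in_quot_eqE.
have -> : (f^-1 * g \in NF2 (K n)) = (val (F2_PB3 (f^-1 * g)) \in K n) by [].
rewrite KP psiF_M psiF_V; split=> [H|->]; last by rewrite mulVg.
by apply: (mulgI (psi n (F2_PB3 f))^-1); rewrite H mulVg.
Qed.

(* j and i are the parities of the exponent sums of x and y in f. *)
Lemma psi_F2_form f : exists (x y z : int) (i j : bool), psi n (F2_PB3 f) =
  trip n (2 * x + i%:Z + j%:Z) i (2 * y + i%:Z) j (2 * z + i%:Z) (i (+) j).
Proof.
move: f; apply: F2_ind => [|||f g].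
- by exists 0%R, 0%R, 0%R, false, false; rewrite !gmulf1 -trip1.
- by exists 0%R, 0%R, 0%R, false, true; rewrite F2_PB3_x psi_x12.
- by exists 0%R, 0%R, 0%R, true, false; rewrite F2_PB3_y psi_x23.
move=> [x [y [z [i [j Ff]]]]] [x' [y' [z' [i' [j' Fg]]]]].
rewrite psiF_M psiF_V Ff Fg tripV tripM.
have half (a e : int) : (2 %| (a - e)%R)%Z -> exists q, a = (2 * q + e)%R.
  by move=> H; exists ((a - e) %/ 2)%Z; lia.
have [|x0 ->] := half (2 * x + i%:Z + j%:Z +
    signed i (signed (~~ i') (2 * x' + i'%:Z + j'%:Z)))%R ((i (+) i')%:Z + (j (+) j')%:Z)%R.
  by case: i i' j j' {Ff Fg} => -[] [] [] /=; lia.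
have [|y0 ->] := half (2 * y + i%:Z + signed j (signed (~~ j') (2 * y' + i'%:Z)))%R
    (i (+) i')%:Z%R.
  by case: i i' j j' {Ff Fg} => -[] [] [] /=; lia.
have [|z0 ->] := half (2 * z + i%:Z +
    signed (i (+) j) (signed (~~ (i' (+) j')) (2 * z' + i'%:Z)))%R (i (+) i')%:Z%R.
  by case: i i' j j' {Ff Fg} => -[] [] [] /=; lia.
exists x0, y0, z0, (i (+) i'), (j (+) j'); rewrite GRing.addrA; congr trip.
by case: i i' j j' {Ff Fg} => -[] [] [].
Qed.

(** This is the image under psi of the derived subgroup of F2. The parity conditions are asked of
    one choice of integer exponents, not of their classes modulo n. *)
Definition rot_lattice (d : dihedral3 n) : Prop := exists x y z : int,
  [/\ d = trip n (2 * x) false (2 * y) false (2 * z) false,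
      (2 %| (x - y)%R)%Z & (2 %| (x - z)%R)%Z].

Lemma rot_latticeF d d' : rot_lattice d -> rot_lattice d' -> rot_lattice (d * d'^-1).
Proof.
move=> [x [y [z [-> Hy Hz]]]] [x' [y' [z' [-> Hy' Hz']]]].
exists (x - x')%R, (y - y')%R, (z - z')%R; split; [|lia|lia].
by rewrite tripV tripM; congr trip => /=; lia.
Qed.

Lemma rot_latticeI a b c : (2 %| a)%Z -> (4 %| (a - b)%R)%Z -> (4 %| (a - c)%R)%Z ->
  rot_lattice (trip n a false b false c false).
Proof.
move=> Ha Hb Hc; exists (a %/ 2)%Z, (b %/ 2)%Z, (c %/ 2)%Z.
by split; [congr trip; lia | lia | lia].
Qed.

(** The parities recorded in [psi_F2_form] suffice: in each of the 16 cases the exponents of the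
    commutator are even and congruent modulo 4. *)
Lemma rot_lattice_comm f g : rot_lattice (psi n (F2_PB3 [~ f, g])).
Proof.
have [x [y [z [i [j Ff]]]]] := psi_F2_form f.
have [x' [y' [z' [i' [j' Fg]]]]] := psi_F2_form g.
rewrite /commg /conjg !psiF_M !psiF_V Ff Fg !tripV !tripM.
by case: i i' j j' {Ff Fg} => -[] [] [] /=; apply: rot_latticeI; lia.
Qed.

(** The element found lies in [F2, F2] itself, not merely modulo K: it is a product of powers of the
    commutator of x and y and of its conjugates by x and y. *)
Lemma rot_lattice_derived d : rot_lattice d ->
  exists2 f, f \in derived F2 & psi n (F2_PB3 f) = d.
Proof.
move=> [x [y [z [-> Hy Hz]]]].
have DM (f g : F2) : f \in derived F2 -> g \in derived F2 -> f * g \in derived F2.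
  exact: (group_closedM (sg_closed (derived F2))).
have DZ (f : F2) k : f \in derived F2 -> zexpg f k \in derived F2.
  move=> Df; have DX e : f ^+ e \in derived F2.
    elim: e => [|e IHe]; first by have [] := sg_closed (derived F2).
    by rewrite expgS; apply: DM.
  by case: k => k //=; apply: (group_closedV (sg_closed (derived F2))).
have Dc (f g : F2) : [~ f, g] \in derived F2 by apply: gen_sub; exists f, g.
have [w Dw Fw] : exists2 w, forall h, w ^ h \in derived F2 &
    psi n (F2_PB3 w) = trip n (- 2) false 2 false (- 2) false.
  exists [~ Fx, Fy] => [h|]; first by rewrite conjRg.
  by rewrite /commg /conjg !psiF_M !psiF_V F2_PB3_x F2_PB3_y psi_x12 psi_x23 !tripV !tripM.
have Fwx : psi n (F2_PB3 (w ^ Fx)) = trip n (- 2) false (- 2) false 2 false.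
  by rewrite /conjg !psiF_M !psiF_V Fw F2_PB3_x psi_x12 !tripV !tripM.
have Fwy : psi n (F2_PB3 (w ^ Fy)) = trip n 2 false 2 false 2 false.
  by rewrite /conjg !psiF_M !psiF_V Fw F2_PB3_y psi_x23 !tripV !tripM.
(* The three vectors (-2,2,-2), (-2,-2,2), (2,2,2) generate the lattice. *)
exists (zexpg w ((y - x) %/ 2)%Z * zexpg (w ^ Fx) ((z - x) %/ 2)%Z *
        zexpg (w ^ Fy) ((y + z)%R %/ 2)%Z).
  by apply: (DM); [apply: (DM)|]; apply: DZ; rewrite // -[w]conjg1.
rewrite !psiF_M !psiF_Z Fw Fwx Fwy !zexpg_trip !zexpg_dih !tripM /=.
by congr trip; lia.
Qed.

Lemma derived_psi f : in_quot (NF2 (K n)) f \in derived (quot (NF2 (K n))) <->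
  rot_lattice (psi n (F2_PB3 f)).
Proof.
split=> [Df|/rot_lattice_derived[g Dg /esym/NF2_cosetP ->]]; last first.
  pose S : {pred F2} := [pred g | in_quot (NF2 (K n)) g \in derived (quot (NF2 (K n)))].
  have Sc : group_closed S.
    have [D1 DF] := sg_closed (derived (quot (NF2 (K n)))).
    by split=> [|x y]; rewrite !inE ?gmulf1 // gmulfF; apply: DF.
  apply: (@gen_min _ _ (Subgroup Sc) _ _ Dg) => _ [x [y ->]].
  by rewrite inE gmulfR; apply: gen_sub; eexists; eexists.
pose S : {pred quot (NF2 (K n))} :=
  [pred q | `[< exists2 g, q = in_quot (NF2 (K n)) g & rot_lattice (psi n (F2_PB3 g)) >]].
have Sc : group_closed S.
  split=> [|x y]; rewrite !inE.
    apply/asboolP; exists 1; rewrite ?gmulf1 // -trip1.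
    by apply: rot_latticeI.
  move=> /asboolP[g -> Hg] /asboolP[h -> Hh]; apply/asboolP.
  exists (g * h^-1); first by rewrite gmulfF.
  by rewrite psiF_M psiF_V; apply: rot_latticeF.
have : in_quot (NF2 (K n)) f \in Subgroup Sc.
  apply: gen_min Df => _ [x [y ->]]; elim/quotW: x => x; elim/quotW: y => y.
  apply/asboolP; exists [~ x, y]; first by rewrite gmulfR.
  exact: rot_lattice_comm.
by move=> /asboolP[g /NF2_cosetP ->].
Qed.

End Derived.

(** * The order of K *)

Lemma presented_ind (I : choiceType) (rels : seq (word I * word I))
    (P : presented rels -> Prop) :
  P 1 -> (forall i, P (pgen rels i)) -> (forall g h, P g -> P h -> P (g * h^-1)) ->
  forall g, P g.
Proof.
move=> P1 Pg PF.
have PV h : P h -> P h^-1 by move=> Ph; rewrite -[_^-1]mul1g; apply: PF.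
have PM g h : P g -> P h -> P (g * h) by move=> Gg Ph; rewrite -[h]invgK; apply/PF/PV.
elim/pwordW=> u; rewrite pwordE; elim: u => [|[i b] u IHu].
  by rewrite /word_val big_nil.
rewrite /word_val big_cons; apply: PM => //.
by rewrite /letter; case: b => /=; [apply/PV/Pg | apply: Pg].
Qed.

Lemma PB3_ind (P : PB3 -> Prop) : P 1 -> P px12 -> P px23 -> P pc ->
  (forall f g, P f -> P g -> P (f * g^-1)) -> forall f, P f.
Proof.
move=> P1 Px Py Pc PM f.
pose S : {pred B3} := [pred g | `[< exists2 h : PB3, val h = g & P h >]].
have Sc : group_closed S.
  split=> [|x y]; rewrite !inE; first by apply/asboolP; exists 1.
  move=> /asboolP[x' <- Hx] /asboolP[y' <- Hy]; apply/asboolP.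
  by exists (x' * y'^-1); [rewrite gmulfF | apply: PM].
have : val f \in Subgroup Sc.
  apply: gen_min (PB3_gen (valP f)) => _ [] ->; apply/asboolP.
  - by exists px12.
  - by exists px23.
  - by exists pc.
by move=> /asboolP[h H]; rewrite (val_inj H).
Qed.

Lemma gorder_eq (G : groupType) (g : G) d : 0 < d ->
  (forall k, g ^+ k = 1 <-> d %| k) -> gorder g = d.
Proof.
move=> d_gt0 Hd; rewrite /gorder; case: pselect => [H|[]]; last first.
  by exists d; rewrite d_gt0; apply/eqP/Hd.
case: ex_minnP => k /andP[k_gt0 /eqP/Hd dk] Hmin.
apply/eqP; rewrite eqn_leq (dvdn_leq k_gt0 dk) andbT; apply: Hmin.
by rewrite d_gt0; apply/eqP/Hd.
Qed.

Section Nord.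
Variable n : nat.
Hypotheses (n_gt2 : 2 < n) (n_even : ~~ odd n).

Lemma K_expgP (h : PB3) k : in_quot (K n) (val h) ^+ k = 1 <-> psi n (zexpg h k) = 1.
Proof.
rewrite -gmulfXn in_quot1P -KP.
by rewrite (_ : val h ^+ k = val (zexpg h k)) // val_zexpg.
Qed.

(** The images of x12 and x23 have both a rotation coordinate of order n and a reflection
    coordinate, so their order is lcm(n, 2) = n; c becomes trivial. *)
Lemma Nord_K : Nord (K n) = n.
Proof.
have n_gt0 : 0 < n by lia.
have d2 (k : nat) : ((n %| k) -> ~~ odd k).
  by move=> /dvdnP[q ->]; rewrite oddM (negPf n_even) andbF.
rewrite /Nord (_ : gorder (in_quot (K n) x12) = n); last first.
  apply: gorder_eq => // k; rewrite (K_expgP px12).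
  have [p [Hk|Hk]] := int_parity k; rewrite Hk ?psi_x12_even ?psi_x12_odd -trip1 trip_eqP //.
    split=> [[_ _ _ []]|H]; first by rewrite !GRing.subr0 -Hk dvdzE.
    by split=> //; split; rewrite GRing.subr0 ?dvdz0 // -Hk dvdzE.
  split=> [[]//|/d2]; lia.
rewrite (_ : gorder (in_quot (K n) x23) = n); last first.
  apply: gorder_eq => // k; rewrite (K_expgP px23).
  have [p [Hk|Hk]] := int_parity k; rewrite Hk ?psi_x23_even ?psi_x23_odd -trip1 trip_eqP //.
    split=> [[_ _ _ []]|H]; first by rewrite !GRing.subr0 -Hk dvdzE.
    by split=> //; split; rewrite GRing.subr0 ?dvdz0 // -Hk dvdzE.
  split=> [[]//|/d2]; lia.
rewrite (_ : gorder (in_quot (K n) c) = 1%N); last first.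
  apply: gorder_eq => // k; rewrite dvd1n (K_expgP pc).
  by rewrite gmulf_zexpg psi_c /= expg1n.
by rewrite lcmn1; apply/eqP; rewrite eqn_dvd dvdn_lcml dvdn_lcm dvdnn.
Qed.
End Nord.

(** * The homomorphisms T and E on triples of dihedral elements *)

Lemma kappa_mul2 m : exists q, kappa m = (2 * q)%R.
Proof.
by have [p [->|->]] := int_parity m; rewrite ?kappa_even ?kappa_odd;
  [exists (- p)%R | exists (p + 1)%R]; lia.
Qed.

(** The number 1 - 2 kappa(m) is the factor of [theta] on the third coordinate; being u or -u with u
    = 2m+1, it is invertible modulo n whenever u is. *)
Lemma kappa_unit m : (1 - 2 * kappa m = 2 * m + 1 \/ 1 - 2 * kappa m = - (2 * m + 1))%R.
Proof.
by have [p [->|->]] := int_parity m; rewrite ?kappa_even ?kappa_odd; [left|right]; lia.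
Qed.

Section Theta.
Variables (n : nat) (m k : int).

(** The coefficients are read off from the required images of the generators: with u = 2m+1, they
    are (r^u, s, s) for x12, and (r^(1-4k) s, r^u, r^(1-2kappa(m)) s) for x23, the latter being
    psi(f^-1 x23^u f). *)
Lemma theta_exists : exists th : {hom dihedral3 n -> dihedral3 n},
  forall a1 i1 a2 i2 a3 i3, th (trip n a1 i1 a2 i2 a3 i3) =
    trip n ((2 * m + 1) * a1 + (- 4 * k - 2 * m) * i1%:Z) i1
           ((2 * m + 1) * a2) i2 ((1 - 2 * kappa m) * a3) i3.
Proof.
have [th thE] := @trip_hom_exists n (aff n (2 * m + 1) (- 4 * k - 2 * m))
  (aff n (2 * m + 1) 0) (aff n (1 - 2 * kappa m) 0) idfun (fun _ _ => erefl) erefl.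
exists th => *; rewrite thE /trip_map [LHS]/= !affE.
by rewrite !GRing.mul0r !GRing.addr0.
Qed.

(* The endomorphism of dihedral3 n through which T_{m,f} and E_{m,f} act
   when psi f = (r^2k, r^-2k, r^kappa(m)). *)
Definition theta := sval (cid theta_exists).

Lemma thetaE a1 i1 a2 i2 a3 i3 : theta (trip n a1 i1 a2 i2 a3 i3) =
    trip n ((2 * m + 1) * a1 + (- 4 * k - 2 * m) * i1%:Z) i1
           ((2 * m + 1) * a2) i2 ((1 - 2 * kappa m) * a3) i3.
Proof. exact: (svalP (cid theta_exists)). Qed.

(** The reflection parts are preserved, so only rotations can lie in the kernel, and on these
    [theta] multiplies exponents by units modulo n. *)
Lemma theta_inj d : 2 < n -> coprimez (2 * m + 1)%R n -> theta d = 1 -> d = 1.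
Proof.
move=> n_gt2 co; have [a1 [i1 [a2 [i2 [a3 [i3 ->]]]]]] := trip_surj d.
rewrite thetaE -trip1 !trip_eqP // => -[-> -> -> []].
rewrite !GRing.subr0 GRing.mulr0 GRing.addr0 => H1 H2 H3; split=> //.
have co' : coprimez n (2 * m + 1)%R by rewrite coprimez_sym.
split.
- by rewrite -(Gauss_dvdzr _ co').
- by rewrite -(Gauss_dvdzr _ co').
- rewrite -(Gauss_dvdzr _ co'); move: H3; case: (kappa_unit m) => -> //.
  by rewrite GRing.mulNr GRing.rpredN.
Qed.

Definition gt_psi (f : F2) : Prop :=
  psi n (F2_PB3 f) = trip n (2 * k) false (- (2 * k)) false (kappa m) false.

Variable f : F2.
Hypothesis Ff : gt_psi f.

Lemma psi_E h : psi n (F2_PB3 (E m f h)) = theta (psi n (F2_PB3 h)).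
Proof.
have [Ex Ey] := E_spec m f.
move: h; apply: F2_ind => [|||g h].
- by rewrite !gmulf1.
- rewrite Ex F2_PB3_x psi_x12 thetaE psiF_Z F2_PB3_x -gmulf_zexpg psi_x12_odd.
  by congr trip; lia.
- rewrite Ey F2_PB3_y psi_x23 thetaE !psiF_M psiF_V Ff psiF_Z F2_PB3_y -gmulf_zexpg psi_x23_odd.
  by rewrite tripV !tripM; congr trip => /=; lia.
- by rewrite gmulfF => Eg Eh; rewrite !psiF_M !psiF_V Eg Eh -gmulfF.
Qed.

Variable T : {hom B3 -> quot (K n)}.
Hypothesis HT : is_T m f T.
Hypothesis hex1 : in_quot (K n) (zexpg sigma1 (2 * m + 1)%R * (val f)^-1 *
  zexpg sigma2 (2 * m + 1)%R * val f) =
  in_quot (K n) ((val f)^-1 * sigma1 * sigma2 * zexpg x12 (- m)%R * zexpg c m).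

(** It is enough to treat x12, x23 and c. The first two are squares of the sigma's; for c the first
    hexagon is used. *)
Lemma T_psi h : exists2 h', T (val h) = in_quot (K n) (val h') & psi n h' = theta (psi n h).
Proof.
have [T1 T2] := HT; have psiK (p : PB3) : psi n p = 1 -> in_quot (K n) (val p) = 1.
  by move=> Hp; apply/in_quot1P/KP.
move: h; apply: PB3_ind => [||||g h].
- by exists 1; rewrite ?gmulf1.
- exists (zexpg px12 (2 * m + 1)).
    rewrite val_zexpg gmulfXn T1 -gmulfXn; congr in_quot.
    have -> : zexpg sigma1 (2 * m + 1) ^+ 2 = zexpg (zexpg sigma1 (2 * m + 1)) 2 by [].
    by rewrite -zexpgM GRing.mulrC zexpgM.
  by rewrite psi_x12_odd psi_x12 thetaE; congr trip; lia.
- exists ((F2_PB3 f)^-1 * zexpg px23 (2 * m + 1) * F2_PB3 f).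
    rewrite gmulfXn T2 -gmulfXn; congr in_quot; rewrite expg2 !valM.
    have e : zexpg x23 (2 * m + 1) = zexpg sigma2 (2 * m + 1) * zexpg sigma2 (2 * m + 1).
      rewrite -zexpgD (_ : _ + (2 * m + 1) = 2 * (2 * m + 1))%R; last by lia.
      by rewrite zexpgM.
    by rewrite val_zexpg /= e !mulgA mulgK.
  rewrite psi_x23 thetaE !psiM psiV Ff psi_x23_odd.
  by rewrite tripV !tripM; congr trip => /=; lia.
(* With D = sigma1 sigma2 sigma1, the first hexagon gives T(D) = f^-1 D c^m modulo K. Squaring, T(c)
   = f^-1 (D f^-1 D^-1) c^(2m+1), where D f^-1 D^-1 is a triple conjugate on which psi takes the
   value psi(f). *)
- pose F := F2_PB3 f; pose a1 := PB3_conj sigma1^-1; pose a2 := PB3_conj sigma2^-1.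
  exists (F^-1 * a1 (a2 (a1 F^-1)) * zexpg pc (2 * m + 1)).
    have AB : in_quot (K n) (zexpg sigma1 (2 * m + 1)) * in_quot (K n)
        ((val f)^-1 * zexpg sigma2 (2 * m + 1) * val f) = in_quot (K n)
        ((val f)^-1 * sigma1 * sigma2 * zexpg x12 (- m) * zexpg c m).
      by rewrite -in_quotM !mulgA hex1.
    have cz g : zexpg c m * g = g * zexpg c m by apply/esym/commute_zexpg/c_commute.
    pose D := sigma1 * sigma2 * sigma1.
    have TD : T D = in_quot (K n) ((val f)^-1 * D * zexpg c m).
      have -> : T D = T sigma1 * T sigma2 * T sigma1 by rewrite -!gmulfM.
      rewrite T1 T2 AB -in_quotM; congr in_quot.
      by rewrite sigma1_odd -!mulgA cz !mulgA zexpgN mulgVK.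
    have -> : T (val pc) = T D * T D.
      by rewrite -gmulfM -expg2.
    rewrite TD -in_quotM; congr in_quot.
    have eA : val (a1 (a2 (a1 F^-1))) = D * (val f)^-1 * D^-1.
      by rewrite /= /conjg !invgK /D !invgM !mulgA.
    have eC : zexpg c (2 * m + 1) = D * D * zexpg c m * zexpg c m.
      by rewrite (_ : 2 * m + 1 = 1 + m + m)%R; [rewrite !zexpgD | lia].
    clearbody D; rewrite !valM eA val_zexpg eC -!mulgA cz !mulgA; congr (_ * _ * _).
    by rewrite mulgVK.
  have F1 : psi n F^-1 = trip n (- (2 * k)) false (- - (2 * k)) false (- kappa m) false.
    by rewrite psiV Ff tripV.
  have pz : psi n (zexpg pc (2 * m + 1)) = 1.
    by rewrite gmulf_zexpg psi_c; case: (2 * m + 1)%R => e /=; rewrite expg1n ?invg1.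
  rewrite !psiM F1 pz psi_c gmulf1 mulg1 (psi_conj1 (psi_conj2 (psi_conj1 F1))).
  by rewrite tripM -trip1; congr trip => /=; clear; lia.
- move=> [g' Tg Fg] [h' Th Fh]; exists (g' * h'^-1).
    have -> : T (val (g * h^-1)) = T (val g) * (T (val h))^-1 by rewrite !gmulfF.
    by rewrite Tg Th -!gmulfF.
  by rewrite !psiM !psiV Fg Fh [RHS]gmulfF.
Qed.
End Theta.

(** * Existence, kernel and surjectivity of T_{m,f} *)

Section KernelT.
Variables (n : nat) (m k : int) (f : F2).
Hypotheses (n_gt2 : 2 < n) (co : coprimez (2 * m + 1)%R n) (Ff : gt_psi n m k f).
Hypothesis hex : hexagons (K n) m f.

(** By the first hexagon, both sides of the braid relation for the prescribed images equal f^-1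
    sigma1 sigma2 sigma1 c^m modulo K. *)
Lemma T_exists : exists T : {hom B3 -> quot (K n)}, is_T m f T.
Proof.
have [hex1 _] := hex; rewrite /= in hex1.
set A := zexpg sigma1 (2 * m + 1)%R in hex1.
set B := (val f)^-1 * zexpg sigma2 (2 * m + 1)%R * val f.
pose g (i : bool) := in_quot (K n) (if i then B else A).
have cz h : zexpg c m * h = h * zexpg c m by apply/esym/commute_zexpg/c_commute.
have hAB : in_quot (K n) A * in_quot (K n) B = in_quot (K n)
    ((val f)^-1 * sigma1 * sigma2 * zexpg x12 (- m) * zexpg c m).
  by rewrite -in_quotM -hex1 /B !mulgA.
have j1z := zexpg_intertwine m x12_sigma12.
have Hg p : p \in B3_rels -> word_val g p.1 = word_val g p.2.
  rewrite inE => /eqP -> /=.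
  rewrite /word_val !big_cons !big_nil /letter /= !mulg1 {3}/g mulgA /g hAB -!in_quotM.
  congr in_quot; rewrite /A /B sigma1_odd sigma2_odd.
  have comm : zexpg x12 m * sigma1 = sigma1 * zexpg x12 m.
    by apply/esym/zexpg_intertwine; rewrite /x12 expg2 mulgA.
  have R : zexpg x23 m * sigma2 * sigma1 * sigma2 = sigma1 * sigma2 * sigma1 * zexpg x12 m.
    by rewrite -braidA -(mulgA _ sigma1 sigma2) -j1z -!mulgA comm.
  rewrite -!mulgA cz !mulgA zexpgN mulgVK mulgK.
  by rewrite -(mulgA _ (zexpg x23 m)) -(mulgA _ (_ * sigma2))
    -(mulgA _ (_ * sigma1)) R !mulgA mulgK.
exists (plift Hg); split; first by rewrite pliftE.
by rewrite pliftE.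
Qed.

Variable T : {hom B3 -> quot (K n)}.
Hypothesis HT : is_T m f T.

(** Odd powers of a sigma have the same permutation as that sigma, and f is pure; hence T preserves
    permutations and its kernel lies in PB3. *)
Lemma S3_T g : exists2 g', T g = in_quot (K n) g' & B3_to_S3 g = B3_to_S3 g'.
Proof.
have [T1 T2] := HT.
have SZ (h : B3) j : h \in PB3 -> B3_to_S3 (zexpg h j) = 1.
  by move=> /Defs.kerP Hh; rewrite gmulf_zexpg Hh; case: j => e /=; rewrite expg1n ?invg1.
have Sf : B3_to_S3 (val f) = 1 by apply/Defs.kerP/F2_sub_PB3/valP.
move: g; apply: presented_ind => [|i|g h [g' Tg Sg] [h' Th Sh]].
- by exists 1; rewrite ?gmulf1.
- case: i; [exists ((val f)^-1 * zexpg sigma2 (2 * m + 1)%R * val f)|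
            exists (zexpg sigma1 (2 * m + 1)%R)] => //.
    rewrite -mulgA -/(conjg _ _) gmulfJ Sf conjg1 sigma2_odd gmulfM SZ ?x23_PB3 //.
    by rewrite mul1g.
  by rewrite sigma1_odd !gmulfM SZ ?x12_PB3 // mul1g.
- exists (g' * h'^-1).
    have -> : T (g * h^-1) = T g * (T h)^-1 by rewrite !gmulfF.
    by rewrite Tg Th -!gmulfF.
  by rewrite !gmulfF Sg Sh.
Qed.

(** On PB3 this is the injectivity of [theta]; [S3_T] excludes kernel elements outside PB3. *)
Lemma ker_T g : T g = 1 <-> g \in K n.
Proof.
have [hex1 _] := hex.
have H (h : PB3) : T (val h) = 1 <-> val h \in K n.
  have [h' -> Fh] := T_psi Ff HT hex1 h.
  rewrite in_quot1P !KP Fh; split=> [|->]; last by rewrite gmulf1.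
  exact: theta_inj.
split=> [Tg|Kg]; last first.
  by have := H (PB3_of (K_sub_PB3 Kg)); rewrite /= => ->.
have Pg : g \in PB3.
  apply/Defs.kerP; have [g' Tg' ->] := S3_T g.
  move: Tg'; rewrite Tg => /esym/in_quot1P/K_sub_PB3.
  by move/Defs.kerP.
by have := H (PB3_of Pg); rewrite /= => <-.
Qed.

(** By [ker_T], T induces an injective self-map of the finite set B3/K, which is therefore onto. *)
Lemma T_surj q : exists g, T g = q.
Proof.
have [_ [s Hs]] := K_NFI (n := n) ltac:(lia).
pose phi (p : quot (K n)) := T (generic_quotient.repr p).
have phi_inj : injective phi.
  move=> p r; rewrite /phi => H.
  rewrite -[p]generic_quotient.reprK -[r]generic_quotient.reprK.
  apply/in_quot_eqE/ker_T.
  by rewrite gmulfM gmulfV H mulVg.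
have us := undup_uniq s.
have Hmap : uniq (map phi (undup s)) by rewrite map_inj_uniq.
have Hsub : {subset map phi (undup s) <= undup s} by move=> x _; rewrite mem_undup.
have [|_ Heq] := uniq_min_size Hmap Hsub; first by rewrite size_map.
have : q \in map phi (undup s) by rewrite Heq mem_undup.
by move=> /mapP[p _ ->]; exists (generic_quotient.repr p).
Qed.
End KernelT.

(** * The explicit description of GT(K), and isolation *)

Section GTCond.
Variable n : nat.
Hypotheses (n_gt2 : 2 < n) (n_even : ~~ odd n).

(* The divisibility by 4 says k = kappa m / 2 mod 2, as kappa m is even. *)
Definition gt_data (m : int) (f : F2) (k : int) : Prop :=
  [/\ gt_psi n m k f, coprimez (2 * m + 1)%R n &
      4 %| n -> (4 %| (2 * k - kappa m)%R)%Z].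

Lemma rot_lattice_data m k : (4 %| n -> (4 %| (2 * k - kappa m)%R)%Z) ->
  rot_lattice (trip n (2 * k) false (- (2 * k)) false (kappa m) false).
Proof.
move=> k4; have [q Hq] := kappa_mul2 m.
have [n4|n4] := boolP (4 %| n).
  by apply: rot_latticeI; move: (k4 n4); lia.
have [e|e] := boolP (2 %| (k - q)%R)%Z.
  by apply: rot_latticeI; lia.
(* n / 2 is odd, so adding n to 2 k changes the parity of k. *)
rewrite (_ : trip _ _ _ _ _ _ _ =
  trip n (2 * k + n%:Z) false (- (2 * k + n%:Z)) false (kappa m) false).
  by apply: rot_latticeI; lia.
apply/trip_eqP => //; split=> //; split; last by rewrite GRing.subrr.
  by rewrite GRing.opprD GRing.addNKr GRing.rpredN dvdzz.
by rewrite GRing.opprK GRing.addKr dvdzz.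
Qed.

(** The explicit description of GT(K), stated for arbitrary representatives m and f of a class. *)
Lemma GT_condP m f : GT_cond (K n) m f <-> exists k, gt_data m f k.
Proof.
split=> [[hex co /derived_psi[x [y [z [Ff xy xz]]]] _]|[k [Ff co k4]]].
  rewrite (Nord_K n_gt2 n_even) in co.
  move/(hexagons_rot _ n_gt2 Ff): hex => [H1 H2].
  exists x; split=> // [|n4].
    rewrite /gt_psi Ff; apply/trip_eqP => //; split=> //; split=> //.
      by rewrite GRing.subrr.
    by rewrite GRing.opprK GRing.addrC.
  (* The third coordinate gives 2z = kappa(m) modulo n, hence modulo 4; as x and z have the same
     parity, this passes to 2x. *)
  have H4 : (4 %| (2 * z - kappa m)%R)%Z by apply: dvdz_trans H1; rewrite dvdzE.
  lia.
have hex : hexagons (K n) m f.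
  by apply/(hexagons_rot _ n_gt2 Ff); rewrite !GRing.subrr.
split=> //.
- by rewrite Nord_K.
- by apply/derived_psi; rewrite Ff; apply: rot_lattice_data.
have [T HT] := T_exists hex; exists T => // q.
exact: (T_surj n_gt2 co Ff hex HT q).
Qed.

Lemma K_isolated : isolated (K n).
Proof.
split; first by apply: K_NFI; lia.
move=> m f T /[dup] [[hex _ _ _]] /GT_condP[k [Ff co _]] HT g.
exact: (ker_T n_gt2 co Ff hex HT g).
Qed.
End GTCond.

(** * Composition of shadows *)

Section Composition.
Variable n : nat.
Hypotheses (n_gt2 : 2 < n) (n_even : ~~ odd n).

Lemma mk_shadowP m f m' f' : mk_shadow (K n) m f = mk_shadow (K n) m' f' <->
  (n %| (m - m')%R)%Z /\ psi n (F2_PB3 f) = psi n (F2_PB3 f').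
Proof.
rewrite /mk_shadow Nord_K // -eqz_mod_dvd -NF2_cosetP.
by split=> [[-> ->]|[/eqP -> ->]].
Qed.

(** As n is even, m and m' have the same parity, and on each parity class kappa is affine of slope 1
    or -1. *)
Lemma kappa_congr m m' : (n %| (m - m')%R)%Z -> (n %| (kappa m - kappa m')%R)%Z.
Proof.
move=> Hm; have H2 : (2 %| (m - m')%R)%Z.
  by apply: dvdz_trans Hm; rewrite dvdzE /= dvdn2.
have [p Hp] := int_parity m; have [p' Hp'] := int_parity m'.
case: Hp Hp' Hm H2 => -> [] -> Hm H2; [|lia|lia|].
  by rewrite !kappa_even (_ : _ - _ = - (2 * p - 2 * p'))%R ?GRing.rpredN //; lia.
rewrite !kappa_odd (_ : 2 * p + 2 - (2 * p' + 2) = 2 * p + 1 - (2 * p' + 1))%R //; lia.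
Qed.

(** Equivalently, 1 - 2 kappa is multiplicative in u = 2m+1: it is whichever of u and -u is 1 modulo
    4. *)
Lemma kappa_comp m1 m2 :
  kappa (2 * m1 * m2 + m1 + m2)%R = (kappa m1 + (1 - 2 * kappa m1) * kappa m2)%R.
Proof.
have [p Hp] := int_parity m1; have [q Hq] := int_parity m2.
clear -Hp Hq; case: Hp Hq => -> [] ->.
- rewrite (_ : _ + 2 * q = 2 * (4 * p * q + p + q))%R; last by lia.
  by rewrite !kappa_even; lia.
- rewrite (_ : _ + (2 * q + 1) = 2 * (4 * p * q + 3 * p + q) + 1)%R; last by lia.
  by rewrite kappa_even !kappa_odd; lia.
- rewrite (_ : _ + 2 * q = 2 * (4 * p * q + p + 3 * q) + 1)%R; last by lia.
  by rewrite kappa_even !kappa_odd; lia.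
- rewrite (_ : _ + (2 * q + 1) = 2 * (4 * p * q + 3 * p + 3 * q + 2))%R; last by lia.
  by rewrite kappa_even !kappa_odd; lia.
Qed.

Lemma gt_psi_congr m k f m' k' f' : gt_psi n m k f -> gt_psi n m' k' f' ->
  psi n (F2_PB3 f) = psi n (F2_PB3 f') -> (n %| (2 * k - 2 * k')%R)%Z.
Proof. by move=> -> -> /trip_eqP[//|_ _ _ []]. Qed.

Lemma gt_data_congr m f k m' f' : (n %| (m - m')%R)%Z ->
  psi n (F2_PB3 f) = psi n (F2_PB3 f') -> gt_data n m' f' k -> gt_data n m f k.
Proof.
move=> Hm Hf [Ff co k4]; have Hk := kappa_congr Hm; split=> [||n4].
- rewrite /gt_psi Hf Ff; apply/trip_eqP => //; split=> //; split; rewrite ?GRing.subrr //.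
  by rewrite -GRing.rpredN GRing.opprB.
- have /dvdzP[q Hq] := Hm.
  rewrite (_ : 2 * m + 1 = 2 * q * n%:Z + (2 * m' + 1))%R; last by clear -Hq; lia.
  by rewrite /coprimez gcdzC gcdzMDl gcdzC.
- have {}Hk : (4 %| (kappa m - kappa m')%R)%Z by apply: dvdz_trans Hk; rewrite dvdzE.
  by move: (k4 n4); lia.
Qed.

(** Here the semidirect product law appears: E multiplies the rotation exponent 2 k2 by u1 = 2 m1 +
    1 before it is added to 2 k1. *)
Lemma gt_psi_comp m1 k1 f1 m2 k2 f2 : gt_psi n m1 k1 f1 -> gt_psi n m2 k2 f2 ->
  gt_psi n (2 * m1 * m2 + m1 + m2) (k1 + (2 * m1 + 1) * k2) (f1 * E m1 f1 f2).
Proof.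
move=> P1 P2'; rewrite /gt_psi psiF_M (psi_E P1) P1 P2' thetaE tripM kappa_comp.
by congr trip => /=; clear; lia.
Qed.

Lemma gt_data_comp m1 k1 f1 m2 k2 f2 : gt_data n m1 f1 k1 -> gt_data n m2 f2 k2 ->
  gt_data n (2 * m1 * m2 + m1 + m2) (f1 * E m1 f1 f2) (k1 + (2 * m1 + 1) * k2).
Proof.
move=> [P1 co1 k14] [P2' co2 k24]; split=> [||n4]; first exact: gt_psi_comp.
  rewrite (_ : _ + 1 = (2 * m1 + 1) * (2 * m2 + 1))%R; last by lia.
  by rewrite coprimezMl co1.
have [q Hq] := kappa_mul2 m1; have [q' Hq'] := kappa_mul2 m2.
by rewrite kappa_comp; move: (k14 n4) (k24 n4); rewrite Hq Hq'; lia.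
Qed.

Lemma GT_mk m f k : gt_data n m f k -> exists s : GT (K n), val s = mk_shadow (K n) m f.
Proof.
move=> D; have Hs : mk_shadow (K n) m f \in @GT_pred (K n).
  by apply/asboolP; exists m, f; split=> //; apply/GT_condP => //; exists k.
by exists (Sub (mk_shadow (K n) m f) Hs : GT (K n)).
Qed.

Lemma GT_data (s : GT (K n)) m f : val s = mk_shadow (K n) m f -> exists k, gt_data n m f k.
Proof.
move=> Hs; have := valP s; rewrite /= => /asboolP[m' [f' [Hs' /(GT_condP n_gt2 n_even)[k D]]]].
have : mk_shadow (K n) m f = mk_shadow (K n) m' f' by rewrite -Hs.
by move=> /mk_shadowP[Hm Hf]; exists k; apply: gt_data_congr D.
Qed.

Lemma GT_rep (s : GT (K n)) : exists (m : int) (f : F2) (k : int),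
  [/\ (0 <= m < n%:Z)%R, val s = mk_shadow (K n) m f & gt_data n m f k].
Proof.
have := valP s; rewrite /= => /asboolP[m [f [Hs _]]].
have n_neq0 : (n%:Z != 0)%R by lia.
have Hm : (n %| ((m %% n)%Z - m)%R)%Z by rewrite -eqz_mod_dvd modz_mod.
have Hs' : val s = mk_shadow (K n) (m %% n)%Z f.
  rewrite [val s]Hs; apply/mk_shadowP; split=> //.
  by rewrite -GRing.rpredN GRing.opprB.
have [k D] := GT_data Hs'; exists (m %% n)%Z, f, k; split=> //.
by rewrite modz_ge0 // ltz_pmod //; lia.
Qed.

(** One choice of representatives produces s; the rest shows that the composition formula gives the
    same class for any other choice. *)
Lemma comp_exists (s1 s2 : GT (K n)) : exists s : GT (K n), forall m1 f1 m2 f2,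
  val s1 = mk_shadow (K n) m1 f1 -> val s2 = mk_shadow (K n) m2 f2 ->
  val s = mk_shadow (K n) (2 * m1 * m2 + m1 + m2)%R (f1 * E m1 f1 f2).
Proof.
have [m1 [f1 [k1 [_ Hs1 D1]]]] := GT_rep s1.
have [m2 [f2 [k2 [_ Hs2 D2]]]] := GT_rep s2.
have [s Hs] := GT_mk (gt_data_comp D1 D2).
exists s => m1' f1' m2' f2' Hs1' Hs2'; rewrite Hs.
have [k1' D1'] := GT_data Hs1'; have [k2' D2'] := GT_data Hs2'.
have [Hm1 Hf1] : (n %| (m1 - m1')%R)%Z /\ psi n (F2_PB3 f1) = psi n (F2_PB3 f1').
  by apply/mk_shadowP; rewrite -Hs1.
have [Hm2 Hf2] : (n %| (m2 - m2')%R)%Z /\ psi n (F2_PB3 f2) = psi n (F2_PB3 f2').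
  by apply/mk_shadowP; rewrite -Hs2.
have [P1 _ _] := D1; have [P2 _ _] := D2.
have [P1' _ _] := D1'; have [P2' _ _] := D2'.
have Hk1 := gt_psi_congr P1 P1' Hf1; have Hk2 := gt_psi_congr P2 P2' Hf2.
have Hm : (n %| ((2 * m1 * m2 + m1 + m2) - (2 * m1' * m2' + m1' + m2'))%R)%Z.
  move/dvdzP: Hm1 => [q1 Hq1]; move/dvdzP: Hm2 => [q2 Hq2].
  have -> : m1 = (m1' + q1 * n%:Z)%R by rewrite -Hq1; lia.
  have -> : m2 = (m2' + q2 * n%:Z)%R by rewrite -Hq2; lia.
  by apply/dvdzP; exists (2 * m1' * q2 + 2 * q1 * m2' + 2 * q1 * q2 * n%:Z + q1 + q2)%R; lia.
apply/mk_shadowP; split=> //.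
rewrite (gt_psi_comp P1 P2) (gt_psi_comp P1' P2'); apply/trip_eqP => //; split=> //.
have H : (n %| (2 * (k1 + (2 * m1 + 1) * k2) - 2 * (k1' + (2 * m1' + 1) * k2'))%R)%Z.
  move/dvdzP: Hk1 => [a Ha]; move/dvdzP: Hk2 => [b Hb]; move/dvdzP: Hm1 => [q Hq].
  (* With u = 2m+1, the difference is 2(k1-k1') + u1 (2k2-2k2') + 2k2'(u1-u1'), and u1-u1' = 2qn. *)
  apply/dvdzP; exists (a + (2 * m1 + 1) * b + 4 * k2' * q)%R.
  by rewrite !GRing.mulrDl -!GRing.mulrA -Ha -Hb -Hq; clear; lia.
split=> //; first by rewrite -GRing.rpredN GRing.opprB GRing.opprK GRing.addrC.
exact: kappa_congr.
Qed.

Definition comp s1 s2 := sval (cid (comp_exists s1 s2)).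

Lemma compE s1 s2 m1 f1 m2 f2 :
  val s1 = mk_shadow (K n) m1 f1 -> val s2 = mk_shadow (K n) m2 f2 ->
  val (comp s1 s2) = mk_shadow (K n) (2 * m1 * m2 + m1 + m2)%R (f1 * E m1 f1 f2).
Proof. exact: (svalP (cid (comp_exists s1 s2))). Qed.
End Composition.

(** * The isomorphism *)

Section Rho.
Variable n : nat.
Hypotheses (n_ge4 : 4 <= n) (n_even : ~~ odd n).
Let n_gt2 : 2 < n. Proof. exact: ltnW. Qed.
Let n1_gt1 : 1 < n./2. Proof. by lia. Qed.
Let N_gt1 : 1 < 2 * (2 * n./2). Proof. by lia. Qed.

Let nE : Posz n = (2 * Posz n./2)%R. Proof. by lia. Qed.
Let NE : Posz (2 * (2 * n./2)) = (4 * Posz n./2)%R. Proof. by lia. Qed.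

Lemma Zp_unit_int d (a : int) : 1 < d -> coprimez a d ->
  exists u : {unit 'Z_d}, val u = (a%:~R)%R.
Proof.
move=> d_gt1 co; have d_neq0 : (d%:Z != 0)%R by lia.
have [b Hb] : exists b : nat, Posz b = (a %% d)%Z.
  by exists `|(a %% d)%Z|%N; rewrite gez0_abs // modz_ge0.
have e : (a%:~R = b%:R :> 'Z_d)%R.
  by apply/(Zp_int_eq a b d_gt1); rewrite Hb -eqz_mod_dvd modz_mod.
have Ub : (a%:~R : 'Z_d)%R \is a GRing.unit.
  rewrite e unitZpE // coprime_sym; have := co.
  by rewrite /coprimez -gcdz_modl -Hb.
by exists (FinRing.unit 'Z_d Ub).
Qed.

Lemma Zp_val_int d (a : int) (x : 'Z_d) : 1 < d ->
  x = (a%:~R)%R -> (d %| (Posz x - a)%R)%Z.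
Proof. by move=> d_gt1 Hx; apply/(Zp_int_eq _ _ d_gt1); rewrite -Hx -[RHS]natr_Zp. Qed.

Lemma Zred_int (u : {unit 'Z_(2 * (2 * n./2))}) a : val u = (a%:~R)%R ->
  Zred u = (a%:~R)%R.
Proof.
move=> /(Zp_val_int N_gt1) H; apply/(Zp_int_eq (Posz (val u)) a n1_gt1).
by apply: dvdz_trans H; rewrite dvdzE /= mulnA dvdn_mull.
Qed.

Lemma rho_formula_exists (s : GT (K n)) : exists p, rho_formula s p.
Proof.
have [m [f [k [m_lt Hs [Ff co _]]]]] := GT_rep n_gt2 n_even s.
have [|u Hu] := @Zp_unit_int (2 * (2 * n./2)) (2 * m + 1) N_gt1.
  (* Being odd, 2m+1 is prime to 2n as soon as it is prime to n. *)
  rewrite (_ : Posz (2 * (2 * n./2)) = 2 * n%:Z)%R; last by lia.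
  by rewrite coprimezMr co andbT coprimezE coprimen2; lia.
by exists ((k%:~R)%R, u), m, k, f; split=> //; rewrite Ff !dih_r.
Qed.

Definition rho (s : GT (K n)) : Zsd n./2 := sval (cid (rho_formula_exists s)).

(** The value is independent of representatives, inside or outside 0 <= m < n: r^(2k) fixes k modulo
    n/2, and m modulo n fixes 2m+1 modulo 2n. *)
Lemma rhoE (s : GT (K n)) m f k : val s = mk_shadow (K n) m f -> gt_psi n m k f ->
  (rho s).1 = (k%:~R)%R /\ val (rho s).2 = ((2 * m + 1)%:~R)%R.
Proof.
move=> Hs Ff; have [m' [k' [f' [_ Hs' Ff' -> ->]]]] := svalP (cid (rho_formula_exists s)).
have {}Ff' : gt_psi n m' k' f' by rewrite /gt_psi Ff' !dih_r.
have [Hm Hf] : (n %| (m' - m)%R)%Z /\ psi n (F2_PB3 f') = psi n (F2_PB3 f).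
  by apply/mk_shadowP => //; rewrite -Hs.
have Hk : (n %| (2 * k' - 2 * k)%R)%Z by apply: (gt_psi_congr n_gt2 Ff' Ff Hf).
split.
  apply/(Zp_int_eq _ _ n1_gt1); move/dvdzP: Hk => [q Hq]; apply/dvdzP; exists q.
  by move: Hq; rewrite nE; clear; lia.
apply/(Zp_int_eq _ _ N_gt1); move/dvdzP: Hm => [q Hq]; apply/dvdzP; exists q.
by move: Hq; rewrite NE nE; clear; lia.
Qed.

Lemma rho_formulaP s p : rho_formula s p <-> rho s = p.
Proof.
split=> [[m [k [f [_ Hs Ff p1 p2]]]]|<-]; last exact: svalP (cid (rho_formula_exists s)).
have [|r1 r2] := @rhoE s m f k Hs; first by rewrite /gt_psi Ff !dih_r.
case: p (rho s) p1 p2 r1 r2 => [p1 p2] [r1 r2] /= -> H2 -> Hr2; congr (_, _).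
by apply: val_inj; exact: etrans Hr2 (esym H2).
Qed.

(** By [rhoE] the composite may be evaluated at k1 + u1 k2 and at 2(2 m1 m2 + m1 + m2) + 1 = u1
    u2. *)
Lemma rho_comp s t : rho (comp n_gt2 n_even s t) = (rho s * rho t)%g.
Proof.
have [m1 [f1 [k1 [_ Hs [P1 _ _]]]]] := GT_rep n_gt2 n_even s.
have [m2 [f2 [k2 [_ Ht [P2 _ _]]]]] := GT_rep n_gt2 n_even t.
have [r1 r2] := rhoE (compE n_gt2 n_even Hs Ht) (gt_psi_comp P1 P2).
have [s1 s2] := rhoE Hs P1; have [t1 t2] := rhoE Ht P2.
change (rho s * rho t)%g with (Zsd_mul (rho s) (rho t)).
case: (rho _) (rho s) (rho t) r1 r2 s1 s2 t1 t2
  => [r1 r2] [s1 s2] [t1 t2] /= -> Hr2 -> Hs2 -> Ht2.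
rewrite /Zsd_mul /= (Zred_int Hs2); congr (_, _).
  by rewrite intrD intrM.
apply: val_inj; apply: (etrans Hr2); rewrite /= Hs2 Ht2 -intrM; congr (_%:~R)%R.
by clear; lia.
Qed.

Lemma rho_inj : injective rho.
Proof.
move=> s t Hst.
have [m1 [f1 [k1 [_ Hs [P1 _ _]]]]] := GT_rep n_gt2 n_even s.
have [m2 [f2 [k2 [_ Ht [P2 _ _]]]]] := GT_rep n_gt2 n_even t.
have [s1 s2] := rhoE Hs P1; have [t1 t2] := rhoE Ht P2.
have /(Zp_int_eq _ _ n1_gt1)/dvdzP[q Hq] : (k1%:~R = k2%:~R :> 'Z_n./2)%R.
  by rewrite -s1 -t1 Hst.
have /(Zp_int_eq _ _ N_gt1)/dvdzP[q' Hq'] :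
    ((2 * m1 + 1)%:~R = (2 * m2 + 1)%:~R :> 'Z_(2 * (2 * n./2)))%R.
  by rewrite -s2 -t2 Hst.
have Hm : (n %| (m1 - m2)%R)%Z by apply/dvdzP; exists q'; move: Hq'; rewrite NE nE; clear; lia.
have Hk : (n %| (2 * k1 - 2 * k2)%R)%Z by apply/dvdzP; exists q; move: Hq; rewrite nE; clear; lia.
apply: val_inj; rewrite [LHS]Hs [RHS]Ht; apply/mk_shadowP => //; split=> //.
rewrite P1 P2; apply/trip_eqP => //; split=> //; split=> //.
  by rewrite -GRing.rpredN GRing.opprB GRing.opprK GRing.addrC.
exact: kappa_congr.
Qed.

(** For u = 2m+1, nu(u) is kappa(m)/2 up to sign: it is q and kappa(m) = -2q when m = 2q, and it is
    q+1 and kappa(m) = 2q+2 when m = 2q+1. *)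
Lemma HsubP (k m : int) (p : Zsd n./2) : 4 %| n -> p.1 = (k%:~R)%R ->
  val p.2 = ((2 * m + 1)%:~R)%R -> p \in Hsub n./2 = (4 %| (2 * k - kappa m)%R)%Z.
Proof.
move=> n4 /(Zp_val_int n1_gt1) H1 /(Zp_val_int N_gt1) H2.
(* As 4 divides n, n/2 is even and 8 divides 2n; the parity of nu(u) depends only on u modulo 8. *)
have {}H1 : (2 %| (Posz p.1 - k)%R)%Z.
  apply: dvdz_trans H1; rewrite dvdzE; change (2 %| n./2); clear -n4; lia.
have {}H2 : (8 %| (Posz (val p.2) - (2 * m + 1))%R)%Z.
  apply: dvdz_trans H2; rewrite dvdzE; change (8 %| 2 * (2 * n./2)); clear -n4; lia.
rewrite inE /nu; move: (Posz p.1) (Posz (val p.2)) H1 H2 => x y; clear.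
move=> /dvdzP[i Hi] /dvdzP[j Hj].
have {Hi}-> : x = (k + 2 * i)%R by rewrite GRing.mulrC -Hi; lia.
have {Hj}-> : y = (2 * m + 1 + 8 * j)%R by rewrite (GRing.mulrC 8%R) -Hj; lia.
have [q [->|->]] := int_parity m; rewrite ?kappa_even ?kappa_odd.
  rewrite (_ : _ == 1%R); last by lia.
  rewrite (_ : (_ %/ 4)%Z = q + 2 * j)%R; last by lia.
  by apply/idP/idP; lia.
rewrite (_ : _ == 1%R = false); last by lia.
rewrite (_ : (_ %/ 4)%Z = q + 1 + 2 * j)%R; last by lia.
by apply/idP/idP; lia.
Qed.

Lemma Zsd_rep (p : Zsd n./2) : exists k m : int,
  [/\ p.1 = (k%:~R)%R, val p.2 = ((2 * m + 1)%:~R)%R & coprimez (2 * m + 1)%R n].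
Proof.
pose v : nat := val p.2; pose m : int := Posz v./2.
have co : coprime (2 * (2 * n./2)) v.
  by have := valP p.2; rewrite -[val p.2]natr_Zp unitZpE.
have [v_odd co_n] : odd v /\ coprime v n.
  have nE2 : n = (2 * n./2)%N by lia.
  move: co; rewrite -nE2 coprimeMl coprime2n => /andP[-> co].
  by rewrite coprime_sym.
have mE : (2 * m + 1)%R = Posz v by lia.
exists (Posz p.1), m; rewrite mE; split=> //; first by rewrite -[LHS]natr_Zp.
by rewrite -[LHS]natr_Zp.
Qed.

(** Treats both cases at once: when 4 does not divide n the condition is vacuous and this is
    surjectivity. *)
Lemma rho_image p : (exists s, rho s = p) <-> (4 %| n -> p \in Hsub n./2).
Proof.
split=> [[s <-] n4|Hp].
  have [m [f [k [_ Hs [Ff _ k4]]]]] := GT_rep n_gt2 n_even s.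
  by have [r1 r2] := rhoE Hs Ff; rewrite (HsubP n4 r1 r2) k4.
have [k [m [p1 p2 co]]] := Zsd_rep p.
have k4 : 4 %| n -> (4 %| (2 * k - kappa m)%R)%Z.
  by move=> n4; rewrite -(HsubP n4 p1 p2) Hp.
have [f _ Ff] := rot_lattice_derived (rot_lattice_data n_gt2 n_even k4).
have [|s Hs] := @GT_mk n n_gt2 n_even m f k.
  by split.
exists s; have [r1 r2] := rhoE Hs Ff.
rewrite [rho s]surjective_pairing [p]surjective_pairing r1 p1; congr (_, _).
by apply: val_inj; exact: etrans r2 (esym p2).
Qed.

Lemma rho_one : exists e, rho e = 1.
Proof.
by apply/rho_image => n4; rewrite (@HsubP 0 0).
Qed.

(** The set is the image of [rho], so it contains 1 and is closed under products, which suffices in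
    a finite group. *)
Lemma group_set_Hsub : 4 %| n -> group_set (Hsub n./2).
Proof.
move=> n4; apply/group_setP; split.
  by have /rho_image := rho_one; apply.
move=> p q Hp Hq; have /rho_image[s <-] : 4 %| n -> p \in Hsub n./2 by [].
have /rho_image[t <-] : 4 %| n -> q \in Hsub n./2 by [].
by rewrite -rho_comp; move: n4; apply/rho_image; exists (comp n_gt2 n_even s t).
Qed.

(** The group axioms are pulled back along the injective multiplicative map [rho]; an inverse exists
    because the image is closed under inversion. *)
Lemma comp_composition : GT_composition (comp n_gt2 n_even).
Proof.
split; first by move=> s1 s2 m1 f1 m2 f2; apply: compE.
split; first by move=> s t u; apply: rho_inj; rewrite !rho_comp mulgA.
have [e He] := rho_one; exists e.
  by split=> s; apply: rho_inj; rewrite rho_comp He ?mul1g ?mulg1.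
move=> s; have [t Ht] : exists t, rho t = (rho s)^-1.
  apply/rho_image => n4; have Hs : rho s \in Group (group_set_Hsub n4).
    by move: (n4); apply/rho_image; exists s.
  by rewrite -[Hsub _]/(gval (Group (group_set_Hsub n4))) groupV.
by exists t; apply: rho_inj; rewrite rho_comp Ht He ?mulgV ?mulVg.
Qed.

(** The translation of k by 1 exchanges the subgroup with its complement, so the two have the same
    size. *)
Lemma index_Hsub : 4 %| n -> #|[set: Zsd n./2] : Hsub n./2| = 2.
Proof.
move=> n4; pose H := Group (group_set_Hsub n4).
pose g (p : Zsd n./2) : Zsd n./2 := ((p.1 + 1)%R, p.2).
have g_inj : injective g.
  by apply: (can_inj (g := fun p => ((p.1 - 1)%R, p.2))) => -[a u]; rewrite /g /= GRing.addrK.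
have HgC p : (g p \in Hsub n./2) = (p \notin Hsub n./2).
  have [k [m [p1 p2 _]]] := Zsd_rep p.
  have gp1 : (g p).1 = ((k + 1)%:~R)%R by rewrite /= p1 intrD.
  rewrite (HsubP n4 p1 p2) (HsubP (p := g p) n4 gp1 p2).
  by have [q ->] := kappa_mul2 m; clear; lia.
have cardC : #|~: Hsub n./2| = #|Hsub n./2|.
  rewrite -[RHS](card_preimset _ g_inj); apply: eq_card => p.
  by rewrite in_setC -HgC [RHS]inE.
have H_gt0 : 0 < #|H| := cardG_gt0 H.
apply/eqP; rewrite -(eqn_pmul2l H_gt0) (Lagrange (subsetT H)) cardsT -(cardsC (Hsub n./2)).
by rewrite cardC addnn muln2.
Qed.
End Rho.


Theorem proposition4p5 (n : nat) (n_ge4 : 4 <= n) (n_even : ~~ odd n) :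
  isolated (K n) /\
  exists2 comp : GT (K n) -> GT (K n) -> GT (K n),
    GT_composition comp &
    exists rho : GT (K n) -> Zsd n./2,
      [/\ forall s p, rho_formula s p <-> rho s = p,
          forall s t, rho (comp s t) = (rho s * rho t)%g,
          ~~ (4 %| n) -> bijective rho
        & 4 %| n ->
            [/\ injective rho,
                forall p, p \in Hsub n./2 <-> exists s, rho s = p,
                group_set (Hsub n./2)
              & #|[set: Zsd n./2] : Hsub n./2|%g = 2]].
Proof.
split; first by apply: K_isolated => //; apply: ltnW.
eexists; first exact: comp_composition n_ge4 n_even.
exists (rho n_ge4 n_even); split=> [s p|s t|n4|n4].
- exact: rho_formulaP.
- exact: rho_comp.
- have H p : exists s, rho n_ge4 n_even s = p.
    by apply/rho_image => n4'; rewrite n4' in n4.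
  exists (fun p => sval (cid (H p))) => [s|p]; last exact: svalP (cid (H p)).
  exact: rho_inj (svalP (cid (H _))).
- split; [exact: rho_inj | | exact: group_set_Hsub | exact: index_Hsub].
  move=> p; split=> [Hp|]; first by apply/rho_image.
  by move/rho_image; apply.
Qed.
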